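(* Let $d\ge 1$ and $k\geq 2$ be integers and let $\Sigma_k=\{0,\ldots,k-1\}$. Then for every real number $h$ with $0<h<\log k$ there exists a Toeplitz array $x\in(\Sigma_k)^{\mathbb{Z}^d}$ such that the Toeplitz subshift $(\overline{O_{\mathbb{Z}^d}}(x),\mathbb{Z}^d)$ is strictly ergodic and $h_{\mathrm{top}}(\overline{O_{\mathbb{Z}^d}}(x),\mathbb{Z}^d)=h$. Moreover, the maximal equicontinuous factor of $(\overline{O_{\mathbb{Z}^d}}(x),\mathbb{Z}^d)$ is given by the universal $\mathbb{Z}^d$-odometer.
   Context: Let $G=\mathbb{Z}^d$. For a finite alphabet $\Sigma$, the set $\Sigma^G$ of maps $x:G\to\Sigma$ (arrays) carries the product topology, and $G$ acts on it by $(gx)(h)=x(h+g)$. The orbit of $x$ is $O_G(x)=\{gx: g\in G\}$ and $\overline{O_G}(x)$ is its closure, which with the restricted action is a subshift. An array $x\in\Sigma^G$ is a Toeplitz array if for every $g\in G$ there is a finite index subgroup $\Gamma$ of $G$ with $x(g+\gamma)=x(g)$ for all $\gamma\in\Gamma$; then $(\overline{O_G}(x),G)$ is called a Toeplitz subshift. A topological dynamical system (tds) is a compact Hausdorff space with a continuous action of $G$. It is minimal if every orbit is dense, uniquely ergodic if it admits exactly one $G$-invariant Borel probability measure, and strictly ergodic if it is minimal and uniquely ergodic. A factor map is a continuous surjective $G$-equivariant map. The maximal equicontinuous factor is the largest equicontinuous factor (every equicontinuous factor factors through it), unique up to topological conjugacy. Topological entropy of a subshift $X\subseteq\Sigma^G$: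 $h_{\mathrm{top}}(X,G)=\lim_{n\to\infty}\frac{\log\theta_{F_n}(X)}{\#F_n}$, where $(F_n)$ is any Følner sequence of $G$ (finite sets with $\#[(g+F_n)\triangle F_n]/\#F_n\to0$ for all $g\in G$) and $\theta_M(X)=\#\{B\in\Sigma^M : \exists y\in X,\ y|_M=B\}$; the limit exists and is independent of $(F_n)$. The logarithm is natural. For a decreasing sequence $(\Gamma_n)_{n\in\mathbb{N}}$ of finite index subgroups of $G$, the associated $G$-odometer is the inverse limit $\varprojlim_n G/\Gamma_n=\{(\overline{g_n})_n\in\prod_n G/\Gamma_n : \phi_n(\overline{g_{n+1}})=\overline{g_n}\ \forall n\}$, where $\phi_n:G/\Gamma_{n+1}\to G/\Gamma_n$ is the natural map, with the product topology and $G$ acting by coordinatewise addition. A $G$-odometer is universal if every $G$-odometer is a factor of it; for $\mathbb{Z}^d$ it exists and is unique up to isomorphism. *)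

(* Defs.v *)
From HB Require Import structures.
From mathcomp Require Import all_boot all_order all_algebra finmap.
From mathcomp Require Import all_classical all_reals all_analysis.
Import Order.TTheory GRing.Theory Num.Theory.
Import numFieldNormedType.Exports.

Set Implicit Arguments.
Unset Strict Implicit.
Unset Printing Implicit Defensive.

Local Open Scope classical_set_scope.
Local Open Scope ring_scope.
Local Open Scope quotient_scope.

(* Every compact Hausdorff space carries exactly one compatible uniformity, so
   the phase spaces are given as uniform spaces in order to use the library's
   notion of equicontinuity. Pointedness amounts to nonemptiness: factor maps
   need not preserve the distinguished point. As [G] is discrete, joint
   continuity of the action is continuity of each translation. *)
Record tds (G : zmodType) := Tds {
  tds_space :> puniformType;
  act : G -> tds_space -> tds_space;
  act0 : forall x, act 0 x = x;
  actD : forall g h x, act (g + h) x = act g (act h x);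
  act_continuous : forall g, continuous (act g);
  tds_compact : compact [set: tds_space];
  tds_hausdorff : hausdorff_space tds_space
}.
Arguments act {G} _ _ _.

Section Dynamics.
Variable G : zmodType.
Implicit Types X Y Z : tds G.

Definition tds_orbit X (x : X) : set X := range (fun g => act X g x).

Definition minimal X : Prop := forall x : X, dense (tds_orbit x).

Definition borel X : Type := g_sigma_algebraType (@open X).
HB.instance Definition _ X := Measurable.on (borel X).

Definition invariant_measure (R : realType) X (mu : probability (borel X) R) :=
  forall (g : G) (A : set (borel X)), measurable A ->
    mu (act X g @^-1` A) = mu A.

(* A library measure is a function on all sets, of which only the values on
   measurable sets are meaningful. *)
Definition uniquely_ergodic (R : realType) X : Prop :=
  exists mu : probability (borel X) R, invariant_measure mu /\
    forall nu : probability (borel X) R, invariant_measure nu ->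
      forall A, measurable A -> nu A = mu A.

Definition strictly_ergodic (R : realType) X : Prop :=
  minimal X /\ uniquely_ergodic R X.

Definition factor_map X Y (f : X -> Y) : Prop :=
  [/\ continuous f,
      forall y, exists x, f x = y
    & forall g x, f (act X g x) = act Y g (f x)].

Definition equicontinuous_tds X : Prop := equicontinuous [set: G] (act X).

Definition is_max_equicontinuous_factor X Y : Prop :=
  equicontinuous_tds Y /\
  exists2 p : X -> Y, factor_map p &
    forall Z (q : X -> Z), equicontinuous_tds Z -> factor_map q ->
      exists2 r : Y -> Z, factor_map r & q =1 r \o p.

End Dynamics.

Definition pointed_subset (T : uniformType) (A : set T) (a : A) : Type := A.

HB.instance Definition _ (T : uniformType) (A : set T) (a : A) :=
  Uniform.on (pointed_subset a).
HB.instance Definition _ (T : uniformType) (A : set T) (a : A) :=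
  isPointed.Build (pointed_subset a) a.

Section Subsystem.
Variables (G : zmodType) (T : uniformType) (to : G -> T -> T) (A : set T).
Hypotheses (to0 : forall x, to 0 x = x).
Hypotheses (toD : forall g h x, to (g + h) x = to g (to h x)).
Hypotheses (to_cont : forall g, continuous (to g)).
Hypotheses (A_inv : forall g x, A x -> A (to g x)).
Hypotheses (A_compact : compact A) (T_hausdorff : hausdorff_space T).
Variable a : A.

Let S := pointed_subset a.

Definition sub_act (g : G) (x : S) : S :=
  exist _ (to g (val x)) (mem_set (A_inv g (set_mem (svalP x)))).

Lemma sub_act0 x : sub_act 0 x = x.
Proof. by apply: val_inj; rewrite /= to0. Qed.

Lemma sub_actD g h x : sub_act (g + h) x = sub_act g (sub_act h x).
Proof. by apply: val_inj; rewrite /= toD. Qed.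

Lemma sub_val_continuous : continuous (val : S -> T).
Proof. exact: (@initial_continuous _ T (val : A -> T)). Qed.

Lemma sub_act_continuous g : continuous (sub_act g).
Proof.
apply: (@continuous_comp_initial A S T val) => x.
apply: (@continuous_comp S T T val (to g)); last exact: to_cont.
exact: sub_val_continuous.
Qed.

Lemma sub_compact : compact [set: S].
Proof.
move=> F FF _.
have valA : ((val : S -> T) @ F) A.
  apply: (@filterS _ F _ setT); last exact: filterT.
  by move=> x _; exact: (set_mem (svalP x)).
have [p [Ap clFp]] := A_compact (fmap_proper_filter (val : S -> T) FF) valA.
exists (exist _ p (mem_set Ap)); split => // B C FB [_ [[W oW <-] Wp WC]].
have [|q [[x Bx <-] Wx]] := clFp (val @` B) W _ (open_nbhs_nbhs (conj oW Wp)).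
  by apply: (@filterS _ F _ B _ _ FB) => x Bx; exists x.
by exists x; split => //; exact: WC.
Qed.

Lemma sub_hausdorff : hausdorff_space S.
Proof.
move=> x y clxy; apply: val_inj; apply: T_hausdorff => B C nB nC.
have [z [Bz Cz]] := clxy _ _ (sub_val_continuous nB) (sub_val_continuous nC).
by exists (val z).
Qed.

Definition subsystem : tds G :=
  Tds sub_act0 sub_actD sub_act_continuous sub_compact sub_hausdorff.

End Subsystem.

Lemma discrete_continuous (D : discreteTopologicalType) (Y : topologicalType)
  (f : D -> Y) : continuous f.
Proof.
move=> x U /nbhs_singleton Ux; apply: (@filterS _ (nbhs x) _ [set x]).
  by move=> _ ->.
exact: discrete_set1.
Qed.

Lemma prod_continuous (I : Type) (D : I -> topologicalType)
  (X : topologicalType) (f : X -> prod_topology D) :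
  (forall i, continuous (fun x => f x i)) -> continuous f.
Proof.
move=> fc x; apply/cvg_sup => i.
exact: (@continuous_comp_initial _ _ _ (fun q : prod_topology D => q i) f (fc i)).
Qed.

Lemma prod_compact (I : eqType) (D : I -> topologicalType) :
  (forall i, compact [set: D i]) -> compact [set: prod_topology D].
Proof.
move=> /tychonoff; congr (compact _).
by apply/seteqP; split.
Qed.

Notation "{ 'quot' H }" := (@Quotient.quot _ H) : type_scope.

(* Subgroups of [G] are boolean predicates closed under 0 and subtraction; by
   classical logic every subgroup arises in this way. *)
Definition finite_index (G : zmodType) (H : zmodClosed G) : Prop :=
  finite_set [set: {quot H}].

Record odometer_scale (G : zmodType) := OdometerScale {
  scale_group :> nat -> zmodClosed G;
  scale_finite : forall n, finite_index (scale_group n);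
  scale_decr : forall n, {subset scale_group n.+1 <= scale_group n}
}.

Section Odometer.
Variables (G : zmodType) (s : odometer_scale G).

Definition quot_trans n (q : {quot (s n.+1)}) : {quot (s n)} :=
  \pi_({quot (s n)}) (repr q).
Arguments quot_trans n q : clear implicits.

Definition quot_prod : uniformType :=
  prod_topology (fun n => discrete_topology {quot (s n)}).

Definition inverse_limit : set quot_prod :=
  [set q | forall n, quot_trans n (q n.+1) = q n].

Definition quot_act (g : G) (q : quot_prod) : quot_prod :=
  fun n => \pi_({quot (s n)}) g + q n.

Lemma quot_transE n g :
  quot_trans n (\pi_({quot (s n.+1)}) g) = \pi_({quot (s n)}) g.
Proof.
apply/eqP; rewrite -Quotient.idealrBE; apply: scale_decr.
by rewrite Quotient.idealrBE reprK.
Qed.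

Lemma quot_act0 q : quot_act 0 q = q.
Proof. by apply: functional_extensionality_dep => n; rewrite /quot_act raddf0 add0r. Qed.

Lemma quot_actD g h q : quot_act (g + h) q = quot_act g (quot_act h q).
Proof.
by apply: functional_extensionality_dep => n; rewrite /quot_act raddfD addrA.
Qed.

Lemma quot_act_continuous g : continuous (quot_act g).
Proof.
apply: prod_continuous => n q.
pose D m : discreteTopologicalType := discrete_topology {quot (s m)}.
pose f (c : D n) : D n := \pi_({quot (s n)}) g + c.
apply: (@continuous_comp (prod_topology D) (D n) (D n) (@proj _ D n) f).
  exact: proj_continuous.
exact: discrete_continuous.
Qed.

Lemma inverse_limit_inv g q : inverse_limit q -> inverse_limit (quot_act g q).
Proof.
move=> sq n; rewrite /quot_act -(sq n) -[q n.+1]reprK -raddfD.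
by rewrite !quot_transE raddfD.
Qed.

Lemma inverse_limit_compact : compact inverse_limit.
Proof.
pose D m : discreteTopologicalType := discrete_topology {quot (s m)}.
apply: (@subclosed_compact _ _ [set: quot_prod]) => //; last first.
  apply: prod_compact => n; apply: finite_compact; exact: scale_finite.
move=> q clq n.
have nb m : nbhs q [set q' : quot_prod | q' m = q m].
  exact: (@proj_continuous _ D m q [set q m] (@discrete_set1 (D m) (q m))).
have [q' [q'lim [/= <- <-]]] := clq _ (filterI (nb n.+1) (nb n)).
exact: q'lim.
Qed.

Lemma quot_prod_hausdorff : hausdorff_space quot_prod.
Proof.
pose D m : discreteTopologicalType := discrete_topology {quot (s m)}.
by apply: (@hausdorff_product _ D) => n; exact: discrete_hausdorff.
Qed.

Lemma inverse_limit0 : inverse_limit (fun n => 0).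
Proof. by move=> n; rewrite -(raddf0 \pi_({quot (s n.+1)})) quot_transE raddf0. Qed.

Definition odometer : tds G :=
  subsystem quot_act0 quot_actD quot_act_continuous inverse_limit_inv
    inverse_limit_compact quot_prod_hausdorff
    (SigSub (mem_set inverse_limit0) : inverse_limit).

End Odometer.

Definition universal_odometer (G : zmodType) (s : odometer_scale G) : Prop :=
  forall s' : odometer_scale G,
    exists f : odometer s -> odometer s', factor_map f.

Section Shift.
Variables (G : zmodType) (k : nat).

Definition config : uniformType :=
  prod_topology (fun _ : G => discrete_topology 'I_k).

Definition config_shift (g : G) (x : config) : config := fun h => x (h + g).

Definition shift_orbit (x : config) : set config := range (config_shift^~ x).

Lemma shift0 x : config_shift 0 x = x.
Proof. by apply/funext => h; rewrite /config_shift addr0. Qed.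

Lemma shiftD g h x : config_shift (g + h) x = config_shift g (config_shift h x).
Proof. by apply/funext => u; rewrite /config_shift addrA. Qed.

Lemma shift_continuous g : continuous (config_shift g).
Proof.
apply: prod_continuous => h.
exact: (@proj_continuous _ (fun _ : G => discrete_topology 'I_k) (h + g)).
Qed.

Lemma config_hausdorff : hausdorff_space config.
Proof.
apply: (@hausdorff_product _ (fun _ : G => discrete_topology 'I_k)) => h.
exact: discrete_hausdorff.
Qed.

Lemma config_compact : compact [set: config].
Proof. by apply: prod_compact => h; exact/finite_compact/finite_finset. Qed.

Lemma orbit_closure_inv x g y :
  closure (shift_orbit x) y -> closure (shift_orbit x) (config_shift g y).
Proof.
move=> cly B /shift_continuous /cly[_ [[h _ <-] Bh]].
by exists (config_shift g (config_shift h x)); split => //; exists (g + h) => //; exact: shiftD.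
Qed.

Lemma orbit_closure_compact x : compact (closure (shift_orbit x)).
Proof.
exact: (subclosed_compact (@closed_closure _ _) config_compact).
Qed.

Lemma orbit_closure_self x : closure (shift_orbit x) x.
Proof. by apply: subset_closure; exists 0 => //; exact: shift0. Qed.

Definition orbit_closure (x : config) : tds G :=
  subsystem shift0 shiftD shift_continuous (@orbit_closure_inv x)
    (@orbit_closure_compact x) config_hausdorff
    (SigSub (mem_set (@orbit_closure_self x)) : closure (shift_orbit x)).

Definition toeplitz (x : config) : Prop :=
  forall g : G, exists2 H : zmodClosed G, finite_index H &
    forall c, c \in H -> x (g + c) = x g.

Definition complexity (X : set config) (M : {fset G}) : nat :=
  #|[set B : {ffun M -> 'I_k} |
      `[< exists2 y, X y & forall m : M, y (val m) = B m >]]%SET|.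

Definition translate (g : G) (M : {fset G}) : {fset G} :=
  [fset (g + m)%R | m in M]%fset.

Definition symdiff (M N : {fset G}) : {fset G} :=
  ((M `\` N) `|` (N `\` M))%fset.

(* The sets are required to be nonempty because [_ / 0 = 0] would otherwise make
   the empty set invariant. *)
Definition folner (R : realType) (F : nat -> {fset G}) : Prop :=
  (forall n, F n != fset0) /\
  forall g : G,
    (#|` symdiff (translate g (F n)) (F n)|%:R / #|` F n|%:R : R)
      @[n --> \oo] --> (0 : R).

(* The limit does not depend on the Folner sequence, so it is asked along all of
   them; Folner sequences exist whenever [G] is countable. *)
Definition has_topological_entropy (R : realType) (X : set config) (h : R) :=
  forall F : nat -> {fset G}, folner R F ->
    (ln (complexity X (F n))%:R / #|` F n|%:R : R) @[n --> \oo] --> h.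

End Shift.

(* Main.v *)
(* Let [tile n] be boxes increasing to Z^d, each the union of translates of the
   previous one.  Level-0 blocks are the letters; a level-(n+1) block arranges
   level-n blocks on the subtiles of [tile n.+1], always with block number 0 at
   the origin; every level-n block occurs in it, and as often as in any other
   level-(n+1) block.  Nesting the blocks number 0 defines a Toeplitz array x.
   Since a subtile other than the origin is not always filled with block 0, the
   position modulo the n-th lattice can be read off every point of the orbit
   closure.  This gives the factor map onto the odometer; its fibre over 0 is the
   single point x, so points with the same image are proximal, and any
   equicontinuous factor identifies them.  The constant composition of blocks
   makes the frequency of every pattern the same for all invariant measures, up
   to a boundary term.
   By pigeonhole over compositions, the number of admissible level-(n+1) blocks
   loses only a subexponential factor, so the number of blocks used can be tuned
   to about exp(h |tile n|).  Then exp(h |F|) is a lower bound for the complexity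
   of every finite F by a Shearer inequality, and covering F by tiles gives the
   upper bound. *)

Require Import Defs.
From HB Require Import structures.
From mathcomp Require Import all_boot all_order perm all_algebra finmap.
From mathcomp Require Import all_classical all_reals all_analysis.
From mathcomp Require Import measurable_realfun zify ring lra.
Import Order.TTheory GRing.Theory Num.Theory.
Import numFieldNormedType.Exports.

Set Implicit Arguments.
Unset Strict Implicit.
Unset Printing Implicit Defensive.

Local Open Scope classical_set_scope.
Local Open Scope ring_scope.

(** * Tilings and blocks *)

(** The obstacle is that the demands on the blocks pull against each other: pinned letters and a
    common composition cost words, whereas the entropy must come out exactly [h]. The number of
    labels is therefore kept strictly above [exp(h |tile n|)]. If there are [N] labels and the next
    tile has [r] subtiles, the [N ^ r] words exceed [exp(h r |tile n|)] by a factor exponential in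
    [r]. This absorbs the losses, at most [N ^ N] for the pinning and [(r + 1) ^ N] for the
    compositions, because [r] is chosen after [N]. At the next level [exp(h |tile n.+1|)] is
    overshot by a factor of at most [r + 2]: enough to keep the inequality strict and to include the
    words that separate positions, and negligible after division by the volume. Universality only
    constrains the sides: level [n] multiplies them by a multiple of [n + 1], so every finite index
    subgroup contains one of the lattices. *)

(* [corner n g] is the base point of the level-[n] tile containing [g], and
   [tile n] is the tile based at 0. *)
Record tiling (G : zmodType) := Tiling {
  corner : nat -> G -> G;
  tile : nat -> {fset G};
  corner_lvl0 : forall g, corner 0 g = g;
  corner0 : forall n, corner n 0 = 0;
  cornerD : forall n g h, corner n (g + corner n h) = corner n g + corner n h;
  corner_up : forall n g, corner n.+1 (corner n g) = corner n.+1 g;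
  corner_down : forall n g, corner n (corner n.+1 g) = corner n.+1 g;
  tileP : forall n g, (g \in tile n) = (corner n g == 0);
  tile_exhaust : forall g, exists n, corner n g = 0
}.

Section Tiling.
Variables (G : zmodType) (T : tiling G).

Definition lattice n : {pred G} := fun g => corner T n g == g.

Lemma latticeP n g : reflect (corner T n g = g) (g \in lattice n).
Proof. exact: eqP. Qed.

Lemma corner_idem n g : corner T n (corner T n g) = corner T n g.
Proof. by rewrite -[X in corner T n X]add0r cornerD corner0 add0r. Qed.

Lemma corner_lattice n g : corner T n g \in lattice n.
Proof. exact/latticeP/corner_idem. Qed.

Lemma cornerDr n g c : c \in lattice n -> corner T n (g + c) = corner T n g + c.
Proof. by move=> /latticeP <-; rewrite cornerD. Qed.

Lemma cornerDl n g c : c \in lattice n -> corner T n (c + g) = c + corner T n g.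
Proof. by move=> cn; rewrite addrC cornerDr // addrC. Qed.

Lemma corner_latticeN n c : c \in lattice n -> - c \in lattice n.
Proof.
move=> cn; apply/latticeP/eqP; rewrite -subr_eq0 opprK.
by rewrite -cornerDr // addNr corner0.
Qed.

Lemma cornerBr n g c : c \in lattice n -> corner T n (g - c) = corner T n g - c.
Proof. by move=> /corner_latticeN /cornerDr. Qed.

Lemma lattice_subproof n : zmod_closed (lattice n).
Proof.
split; first by apply/latticeP/corner0.
by move=> g h /latticeP gn hn; apply/latticeP; rewrite cornerBr // gn.
Qed.

HB.instance Definition _ n := GRing.isZmodClosed.Build G (lattice n)
  (lattice_subproof n).

Lemma lattice_decr n : {subset lattice n.+1 <= lattice n}.
Proof. by move=> g /latticeP gn; apply/latticeP; rewrite -gn corner_down. Qed.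

Lemma corner_upE n g h : corner T n g = corner T n h ->
  corner T n.+1 g = corner T n.+1 h.
Proof. by rewrite -corner_up => ->; rewrite corner_up. Qed.

Lemma corner_eq_le m n g h : (m <= n)%N ->
  corner T m g = corner T m h -> corner T n g = corner T n h.
Proof.
move=> mn; have [k ->] : exists k, n = (k + m)%N by exists (n - m)%N; rewrite subnK.
by elim: k => [//|k IH] /IH /corner_upE.
Qed.

Lemma tile0n n : 0 \in tile T n.
Proof. by rewrite tileP corner0. Qed.

Lemma tile_le m n : (m <= n)%N -> (tile T m `<=` tile T n)%fset.
Proof.
move=> mn; apply/fsubsetP => g; rewrite !tileP => /eqP g0.
by rewrite (corner_eq_le mn (h := 0)) ?corner0.
Qed.

Lemma tile_window (E : {fset G}) : exists n, (E `<=` tile T n)%fset.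
Proof.
have [f fP] := choice (tile_exhaust T).
exists (\max_(e : E) f (val e))%N; apply/fsubsetP => e eE.
apply: (fsubsetP (tile_le (leq_bigmax (F := fun e : E => f (val e)) [` eE]%fset))).
by rewrite tileP /= fP.
Qed.

Lemma sub_corner_tile n g : g - corner T n g \in tile T n.
Proof. by rewrite tileP cornerBr ?corner_lattice // subrr. Qed.

Definition subtiles n : {fset G} := [fset s in tile T n.+1 | s \in lattice n]%fset.

Lemma subtilesP n s :
  reflect (corner T n.+1 s = 0 /\ corner T n s = s) (s \in subtiles n).
Proof.
rewrite !inE tileP; apply: (iffP andP) => [[/eqP ? /latticeP]//|[-> ?]].
by split=> //; exact/latticeP.
Qed.

Lemma subtile_lattice n s : s \in subtiles n -> s \in lattice n.
Proof. by move=> /subtilesP[_ ?]; apply/latticeP. Qed.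

Lemma subtiles0 n : 0 \in subtiles n.
Proof. by apply/subtilesP; rewrite !corner0. Qed.

Lemma corner_sub_subtile n g : corner T n g - corner T n.+1 g \in subtiles n.
Proof.
apply/subtilesP; split.
  by rewrite cornerBr ?corner_lattice // corner_up subrr.
by rewrite cornerBr ?corner_idem // lattice_decr // corner_lattice.
Qed.

End Tiling.

(* [word n j s] is the label of the level-[n] tile at the subtile [s] of a
   level-[n.+1] tile with label [j < nlab n.+1]; values for other [j] and [s] are
   junk. *)
Record labelling (G : zmodType) (T : tiling G) (k : nat) := Labelling {
  nlab : nat -> nat;
  word : nat -> nat -> G -> nat;
  nlab0 : nlab 0 = k;
  nlab_gt0 : forall n, (0 < nlab n)%N;
  word_lt : forall n j s, (j < nlab n.+1)%N -> (word n j s < nlab n)%N;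
  word_origin : forall n j, word n j 0 = 0%N;
  word_onto : forall n j v, (j < nlab n.+1)%N -> (v < nlab n)%N ->
    exists2 s, s \in subtiles T n & word n j s = v;
  word_type : forall n i j v, (i < nlab n.+1)%N -> (j < nlab n.+1)%N ->
    #|` [fset s in subtiles T n | word n i s == v]%fset| =
    #|` [fset s in subtiles T n | word n j s == v]%fset|;
  word_sep : forall n s, s \in subtiles T n -> s != 0 ->
    exists2 j, (j < nlab n.+1)%N & word n j s != 0%N;
  word_inj : forall n i j, (i < nlab n.+1)%N -> (j < nlab n.+1)%N ->
    (forall s, s \in subtiles T n -> word n i s = word n j s) -> i = j
}.

Section Blocks.
Variables (G : zmodType) (T : tiling G) (k : nat) (L : labelling T k).
Local Notation corner := (corner T).
Local Notation nlab := (nlab L).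
Local Notation word := (word L).

(* The letter at [g] of an array whose level-[n] tile around [g] carries the
   label [j]; labels of level 0 are letters. *)
Fixpoint desc (n j : nat) (g : G) : nat :=
  if n is n'.+1 then desc n' (word n' j (corner n' g - corner n'.+1 g)) g
  else j.

Lemma desc_lt n j g : (j < nlab n)%N -> (desc n j g < k)%N.
Proof.
elim: n j => [|n IH] j /=; first by rewrite nlab0.
by move=> /word_lt jn; exact: IH.
Qed.

(** Only differences of corners enter, and [c] lies in all lower lattices. *)
Lemma descDl n j c g : c \in lattice T n -> desc n j (c + g) = desc n j g.
Proof.
elim: n j => [//|n IH] j cn /=; have cn' := lattice_decr cn.
by rewrite (cornerDl _ cn) (cornerDl _ cn') opprD addrACA subrr add0r IH.
Qed.

Lemma desc_inj n i j : (i < nlab n)%N -> (j < nlab n)%N ->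
  (forall g, corner n g = 0 -> desc n i g = desc n j g) -> i = j.
Proof.
elim: n i j => [|n IH] i j ilt jlt eqij; first exact: (eqij 0 (corner0 T 0)).
apply: (word_inj ilt jlt) => s /[dup] /subtile_lattice sn /subtilesP[s1 s2].
apply: IH => [||g gn]; rewrite ?word_lt //.
have := eqij (s + g); rewrite -corner_up cornerDl // gn addr0 s1 => /(_ erefl) /=.
by rewrite -corner_up cornerDl // gn addr0 s1 subr0 !descDl.
Qed.

(** [f] is a juxtaposition of level-[n] blocks along [lattice n]; other phases are expressed by
    translating [f]. Only the values of [l] at corners matter. *)
Definition concat n (f : G -> 'I_k) :=
  exists2 l : G -> nat, forall g, (l g < nlab n)%N &
    forall g, f g = desc n (l (corner n g)) g :> nat.

Lemma concat_down n f : concat n.+1 f -> concat n f.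
Proof.
move=> [l llt fE].
exists (fun g => word n (l (corner n.+1 g)) (g - corner n.+1 g)) => g.
  exact: word_lt.
by rewrite fE /= corner_up.
Qed.

Lemma concat_shift n f c : c \in lattice T n -> concat n f ->
  concat n (fun g => f (c + g)).
Proof.
move=> cn [l llt fE]; exists (fun g => l (c + g)) => // g.
by rewrite fE descDl // cornerDl.
Qed.

(** Whatever the label of the tile at [c], its subtile at the origin has label 0. This is the source
    of the periodicity of the array. *)
Lemma concat_pinned n f c g : concat n.+1 f -> c \in lattice T n.+1 ->
  corner n g = 0 -> f (c + g) = desc n 0 g :> nat.
Proof.
move=> [l llt fE] cn gn; rewrite fE.
have cn' := lattice_decr cn.
have -> : corner n.+1 (c + g) = c.
  by rewrite cornerDl // -corner_up gn corner0 addr0.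
rewrite /= cornerDl // gn addr0 -[X in c - X]addr0.
have -> : corner n.+1 (c + g) = c.
  by rewrite cornerDl // -corner_up gn corner0 addr0.
by rewrite addr0 subrr word_origin descDl.
Qed.

(* The tile structure is determined by the array: otherwise all subtiles at some
   fixed position [s != 0] would carry the label 0. *)
Lemma concat_lattice n f c : concat n.+1 f -> concat n (fun g => f (c + g)) ->
  c \in lattice T n.
Proof.
elim: n f c => [|n IH] f c fn gn; first exact/latticeP/corner_lvl0.
have cn : c \in lattice T n by apply: (IH f) => //; exact: concat_down.
have [s0|/eqP s0] := eqVneq (c - corner n.+1 c) 0.
  by apply/latticeP/eqP; rewrite -subr_eq0 -oppr_eq0 opprB s0.
set s := c - corner n.+1 c in s0.
have sS : s \in subtiles T n.
  by rewrite /s -{1}(latticeP _ _ _ cn); exact: corner_sub_subtile.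
have [/= s1 s2] := subtilesP _ _ _ sS.
have [j jlt js] := word_sep L sS (introN eqP s0).
have [l llt fE] := fn.
(* In [f] the level-[n.+1] tile at [u] has label [j], so its subtile at [u + s] has label
   [word n j s]. But [u + s] is also a base point of level [n.+1] for the translate, so block 0
   stands there. *)
have [u uS uj] := word_onto (llt 0) jlt.
have [u1 u2] := subtilesP _ _ _ uS.
have uL := subtile_lattice uS.
have sL := subtile_lattice sS.
exfalso; move/eqP: js; apply.
apply: (@desc_inj n); [exact: word_lt|exact: nlab_gt0|move=> g g0].
pose w := u - corner n.+1 c.
have wL : w \in lattice T n.+1.
  by rewrite rpredB ?corner_lattice //; exact/latticeP.
have := concat_pinned gn wL g0.
have -> : c + (w + g) = u + (s + g).
  by rewrite /w /s addrCA -!addrA; congr (u + _); rewrite addrCA.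
rewrite fE => <-.
have sg : corner n.+1 (s + g) = 0 by rewrite -corner_up cornerDl // g0 addr0.
have sg2 : corner n.+2 (s + g) = 0 by rewrite -corner_up sg corner0.
have usg : corner n.+1 (u + (s + g)) = u.
  by rewrite cornerDl ?sg ?addr0 //; apply/latticeP.
have usg2 : corner n.+2 (u + (s + g)) = 0.
  by rewrite -corner_up usg u1.
rewrite usg2 [RHS]/= usg usg2 subr0 uj.
have uL' := lattice_decr uL.
rewrite (cornerDl _ uL') (cornerDl _ sL) g0 addr0 addrAC subrr add0r.
by rewrite !descDl.
Qed.

Lemma concat_all_labels n f v : concat n.+1 f -> (v < nlab n)%N ->
  exists2 s, s \in subtiles T n &
    forall g, corner n g = 0 -> f (s + g) = desc n v g :> nat.
Proof.
move=> [l llt fE] vn; have [s sS sv] := word_onto (llt 0) vn.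
have [s1 s2] := subtilesP _ _ _ sS; have sL := subtile_lattice sS.
exists s => // g g0; rewrite fE.
have sg : corner n (s + g) = s by rewrite cornerDl // g0 addr0.
have sg1 : corner n.+1 (s + g) = 0 by rewrite -corner_up sg.
by rewrite sg1 /= sg sg1 subr0 sv descDl.
Qed.

Lemma desc_refine m n j g0 : (m <= n)%N -> (j < nlab n)%N ->
  exists2 v, (v < nlab m)%N & forall g, corner m g = corner m g0 ->
    desc n j g = desc m v g.
Proof.
move=> mn; have [i ->] : exists i, n = (i + m)%N by exists (n - m)%N; rewrite subnK.
elim: i j => [j jlt|i IH j jlt]; first by exists j.
have [v vlt vE] := IH _ (word_lt (corner (i + m) g0 - corner (i + m).+1 g0) jlt).
exists v => // g gg0; rewrite /= -vE //.
have cE p : (m <= p)%N -> corner p g = corner p g0 by move=> mp;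
  exact: (corner_eq_le mp gg0).
by rewrite (cE (i + m)%N) ?leq_addl // (cE (i + m).+1) // -addSn leq_addl.
Qed.

Definition depth (g : G) : nat := sval (cid (tile_exhaust T g)).

Lemma depthP g : corner (depth g) g = 0.
Proof. exact: (svalP (cid (tile_exhaust T g))). Qed.

Definition array (g : G) : 'I_k :=
  Ordinal (desc_lt g (nlab_gt0 L (depth g))).

(** Block 0 of each level sits at the origin of block 0 of the next, so the letter does not depend
    on the level at which it is read. *)
Lemma arrayE n g : corner n g = 0 -> array g = desc n 0 g :> nat.
Proof.
suff H m m' : (m <= m')%N -> corner m g = 0 -> desc m 0 g = desc m' 0 g.
  move=> gn; rewrite /array /=.
  have gd := depthP g.
  by case: (leqP n (depth g)) => [|/ltnW] ?; [apply/esym|]; exact: H.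
move=> mm' gm; have [i ->] : exists i, m' = (i + m)%N.
  by exists (m' - m)%N; rewrite subnK.
elim: i => [//|i ->] /=.
have g0 j : corner (j + m) g = 0.
  by rewrite (@corner_eq_le _ T m _ g 0) ?corner0 ?leq_addl.
by rewrite g0 (g0 i.+1) subr0 word_origin.
Qed.

Lemma array_concat n : concat n array.
Proof.
have /choice[l lP] : forall c, exists v, (v < nlab n)%N /\
    forall g, corner n g = corner n c -> array g = desc n v g :> nat.
  move=> c; have [m cm] := tile_exhaust T c.
  have mE p : (m <= p)%N -> corner p c = 0.
    by move=> mp; rewrite (@corner_eq_le _ T m _ c 0) ?corner0.
  (* At level [maxn n m] the point [c] lies in the tile at 0, which has label 0; the label of its
     level-[n] tile is read off from there. *)
  have [v vlt vE] := desc_refine c (leq_maxl n m) (nlab_gt0 L (maxn n m)).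
  exists v; split=> // g gc; rewrite -vE //; apply: arrayE.
  by rewrite -(mE _ (leq_maxr n m)); apply: corner_eq_le gc; exact: leq_maxl.
exists l => [g|g]; first by have [] := lP g.
by have [_] := lP (corner n g); apply; rewrite corner_idem.
Qed.

(** Phase zero at level [n.+1] forces the window [tile n]; hence the fibre over 0 is a single
    point. *)
Lemma concat_array n f g : concat n.+1 f -> corner n g = 0 -> f g = array g.
Proof.
move=> fn g0; apply/ord_inj; rewrite (arrayE g0) -(concat_pinned fn (rpred0 _) g0).
by rewrite add0r.
Qed.

End Blocks.

(** * The orbit closure and its odometer factor *)

Section Windows.
Variables (G : zmodType) (k : nat).

Lemma config_nbhsP (z : config G k) (U : set (config G k)) :
  nbhs z U <->
  exists E : {fset G}, forall z' : config G k,
    (forall g, g \in E -> z' g = z g) -> U z'.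
Proof.
split=> [|[E EU]].
  (* The sets containing a cylinder around [z] form a filter, and convergence in a product is tested
     on coordinates. *)
  pose F : set_system (config G k) :=
    [set V : set (config G k) | exists E : {fset G},
    forall z' : config G k, (forall g, g \in E -> z' g = z g) -> V z'].
  have FF : Filter F.
    split; first by exists fset0.
    - move=> A B [E EA] [E' EB]; exists (E `|` E')%fset => z' z'E.
      split; [apply: EA|apply: EB] => g gE; apply: z'E; rewrite inE gE ?orbT //.
    - by move=> A B AB [E EA]; exists E => z' /EA /AB.
  suff Fz : F --> z by move=> /Fz.
  apply/cvg_sup => g V [_ [[W oW <-] Wz WV]].
  exists [fset g]%fset => z' z'g; apply: WV.
  by rewrite /preimage /= z'g // inE.
have nb g : nbhs z [set z' : config G k | z' g = z g].
  exact: (@proj_continuous _ (fun _ : G => discrete_topology 'I_k) g z [set z g]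
    (@discrete_set1 _ _)).
apply: (@filterS _ _ _ (\bigcap_(g in [set` E]) [set z' : config G k | z' g = z
  g])).
  by move=> z' z'E; apply: EU => g gE; exact: z'E.
by apply: filter_bigI => g gE; exact: nb.
Qed.

Lemma orbit_nbhsP (x : config G k) (z : orbit_closure x) (U : set
  (orbit_closure x)) :
  nbhs z U <->
  exists E : {fset G}, forall z' : orbit_closure x,
    (forall g, g \in E -> val z' g = val z g) -> U z'.
Proof.
split.
  move=> [_ [[W oW <-] Wz WU]].
  have /config_nbhsP[E EW] : nbhs (val z) W by apply: open_nbhs_nbhs.
  by exists E => z' /EW z'W; exact: WU.
move=> [E EU].
pose V := [set z' : config G k | forall g, g \in E -> z' g = val z g].
have nV : nbhs (val z) V by apply/config_nbhsP; exists E.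
apply: (@filterS _ _ _ (val @^-1` V)); first by move=> z' /EU.
exact: (@sub_val_continuous _ _ _ z _ nV).
Qed.

Lemma orbit_closureP (x z : config G k) :
  closure (shift_orbit x) z <->
  forall E : {fset G}, exists g, forall e, e \in E -> x (e + g) = z e.
Proof.
split=> [clz E|H B /config_nbhsP[E EB]].
  pose V := [set z' : config G k | forall g, g \in E -> z' g = z g].
  have nV : nbhs z V by apply/config_nbhsP; exists E.
  have [_ [[g _ <-] Vg]] := clz _ nV.
  by exists g => e /Vg.
have [g gP] := H E; exists (config_shift g x); split; first by exists g.
by apply: EB.
Qed.

Lemma val_act (x : config G k) g (z : orbit_closure x) h :
  val (act (orbit_closure x) g z) h = val z (h + g).
Proof. by []. Qed.

End Windows.

(** A basic entourage is a finite intersection of coordinate entourages, each of which contains the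
    diagonal. *)
Lemma discrete_prod_entourage (T : nat -> choiceType)
    (E : set (prod_topology (fun n => discrete_topology (T n)) *
              prod_topology (fun n => discrete_topology (T n)))) :
  entourage E -> exists n, forall q q', (forall m, (m < n)%N -> q m = q' m) ->
    E (q, q').
Proof.
move=> [_ [D _ <-] DE].
have H : forall p, p \in D -> exists n, forall q q' : prod_topology (fun n =>
  discrete_topology (T n)),
   (forall m, (m < n)%N -> q m = q' m) -> (projT1 p).2 (q, q').
  move=> [[i V] iV] pD; have /asboolP[W eW WV] := iV.
  exists i.+1 => q q' qq'.
  apply: WV; rewrite /preimage /= /proj /=.
  suff : W (q i, q' i) by [].
  by rewrite (qq' i) //; exact: entourage_refl.
have /choice[f fP] : forall p, exists n, p \in D ->
  forall q q' : prod_topology (fun n => discrete_topology (T n)),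
   (forall m, (m < n)%N -> q m = q' m) -> (projT1 p).2 (q, q').
  move=> p; have [pD|pD] := boolP (p \in D); last by exists 0%N.
  by have [n nP] := H _ pD; exists n.
exists (\max_(p : D) f (val p))%N => q q' qq'; apply: DE => p pD.
apply: (fP _ pD) => m mlt; apply: qq'; apply: (leq_trans mlt).
exact: (leq_bigmax (F := fun p : D => f (val p)) [` pD]%fset).
Qed.

(** * Odometers: coordinates, equicontinuity, universality *)

Section Odometers.
Local Open Scope quotient_scope.
Variables (G : zmodType).
Implicit Types s : odometer_scale G.

Lemma pi_eqP (H : zmodClosed G) (g h : G) :
  (\pi_({quot H}) g = \pi_({quot H}) h) <-> (g - h \in H).
Proof. by rewrite Quotient.idealrBE; split=> [->|/eqP]. Qed.

Lemma repr_pi_sub (H : zmodClosed G) (g : G) :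
  repr (\pi_({quot H}) g) - g \in H.
Proof. by apply/pi_eqP; rewrite reprK. Qed.

Lemma scale_le s m n : (m <= n)%N -> {subset s n <= s m}.
Proof.
move=> mn; have [i ->] : exists i, n = (i + m)%N by exists (n - m)%N; rewrite subnK.
by elim: i => [//|i IH] g /(@scale_decr _ s) /IH.
Qed.

Lemma odometer_coord s (q : odometer s) m n : (m <= n)%N ->
  val q m = \pi_({quot (s m)}) (repr (val q n)).
Proof.
move=> mn; have [i ->] : exists i, n = (i + m)%N by exists (n - m)%N; rewrite subnK.
elim: i => [|i IH]; first by rewrite add0n reprK.
have ql : inverse_limit (val q) := set_mem (svalP q).
rewrite IH -(ql (i + m)%N); apply/pi_eqP; rewrite /quot_trans.
by apply: (@scale_le s m (i + m)); [exact: leq_addl|exact: repr_pi_sub].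
Qed.

Lemma odometer_repr_sub s (q : odometer s) i j m : (m <= i)%N -> (m <= j)%N ->
  repr (val q i) - repr (val q j) \in s m.
Proof. by move=> mi mj; apply/pi_eqP; rewrite -!odometer_coord. Qed.

Lemma odometer_eq s (q q' : odometer s) : (forall n, val q n = val q' n) -> q = q'.
Proof. by move=> qq'; apply/val_inj/functional_extensionality_dep. Qed.

Lemma odometer_entourage s (E : set (odometer s * odometer s)) : entourage E ->
  exists n, forall q q' : odometer s,
    (forall m, (m < n)%N -> val q m = val q' m) -> E (q, q').
Proof.
move=> [V eV VE].
have [n nV] := @discrete_prod_entourage (fun m => {quot (s m)}) V eV.
by exists n => q q' qq'; apply: VE; exact: nV.
Qed.

Lemma odometer_nbhs s (q : odometer s) n :
  nbhs q [set q' : odometer s | val q' n = val q n].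
Proof.
pose D m : discreteTopologicalType := discrete_topology {quot (s m)}.
have nV : nbhs (val q) [set q' : quot_prod s | q' n = val q n].
  exact: (@proj_continuous _ D n (val q) [set val q n] (@discrete_set1 (D n) _)).
exact: (@sub_val_continuous _ _ _ q _ nV).
Qed.

Lemma odometer_equicontinuous s : equicontinuous_tds (odometer s).
Proof.
move=> q E /odometer_entourage[n nE].
have : nbhs q (\bigcap_(m in [set` [fset nat_of_ord i | i in 'I_n]%fset])
  [set q' : odometer s | val q' m = val q m]).
  by apply: filter_bigI => i _; exact: odometer_nbhs.
apply: filterS => q' q'q g _; apply: nE => m mn.
have /= := q'q m; rewrite /quot_act => -> //.
by apply/imfsetP; exists (Ordinal mn).
Qed.

Lemma odometer_continuous (X : topologicalType) s (f : X -> odometer s) :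
  (forall z n, nbhs z [set z' | val (f z') n = val (f z) n]) -> continuous f.
Proof.
move=> fnb; pose D m : discreteTopologicalType := discrete_topology {quot (s m)}.
have vc : continuous (fun z => val (f z) : quot_prod s).
  apply: (@prod_continuous _ D) => n z U /nbhs_singleton Uz.
  by apply: filterS (fnb z n) => z' /= ->.
by move=> z; apply: (@continuous_comp_initial _ _ _ val f vc).
Qed.

(** Surjectivity is automatic: the image is compact, hence closed, and a translate of any image
    point agrees with [y] up to a given coordinate. *)
Lemma odometer_factor_map (X : tds G) s (f : X -> odometer s) :
  continuous f -> (forall g x, f (act X g x) = act (odometer s) g (f x)) ->
  factor_map f.
Proof.
move=> fc fe; split=> // y.
have /compact_closed : compact (f @` [set: X]).
  apply: continuous_compact; last exact: tds_compact.
  by apply/continuous_subspaceT.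
move=> /(_ (@tds_hausdorff _ (odometer s)) y); case; last by move=> x _ <-;
  exists x.
move=> B /nbhsP[E /odometer_entourage[n nE] EB].
pose q0 := f point.
pose g := repr (val y n) - repr (val q0 n).
exists (f (act X g point)); split; first by exists (act X g point).
apply: EB; apply/mem_set; apply: nE => m mn.
rewrite fe /= /quot_act -/q0 (odometer_coord y (ltnW mn)).
rewrite (odometer_coord q0 (ltnW mn)) -raddfD; apply/pi_eqP.
by rewrite /g subrK subrr rpred0.
Qed.

(** Cofinality suffices: a class modulo [s' n] can be read off a class modulo any [s m] contained in
    [s' n]. *)
Lemma universal_odometerP s :
  (forall H : zmodClosed G, finite_index H -> exists n, {subset s n <= H}) ->
  universal_odometer s.
Proof.
move=> su s'.
have /choice[j jP] : forall n, exists m, {subset s m <= s' n}.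
  by move=> n; exact/su/scale_finite.
pose f (q : odometer s) : quot_prod s' :=
  fun n => \pi_({quot (s' n)}) (repr (val q (j n))).
have fE (q : odometer s) n m : (j n <= m)%N -> f q n = \pi_({quot (s' n)})
  (repr (val q m)).
  by move=> jm; apply/pi_eqP; apply: jP; exact: odometer_repr_sub.
have fl q : inverse_limit (f q).
  move=> n; rewrite (fE q n.+1 _ (leq_maxr (j n) _)) quot_transE.
  by rewrite (fE q n _ (leq_maxl _ (j n.+1))).
pose F q : odometer s' := exist _ (f q) (mem_set (fl q)).
exists F; apply: odometer_factor_map.
  apply: odometer_continuous => q n.
  by apply: filterS (odometer_nbhs q (j n)) => q' q'q;
    exact: (congr1 (fun t => \pi_({quot (s' n)}) (repr t)) q'q).
move=> g q; apply: odometer_eq => n /=; rewrite /f /quot_act /= /quot_act.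
rewrite -raddfD; apply/pi_eqP; apply: jP.
have := repr_pi_sub (s (j n)) (g + repr (val q (j n))).
by rewrite raddfD /= reprK.
Qed.

End Odometers.

Section LatticeScale.
Local Open Scope quotient_scope.
Variables (G : zmodType) (T : tiling G).

Lemma lattice_finite n : finite_index (lattice T n).
Proof.
apply: (@sub_finite_set _ _ ((fun g =>
  \pi_({quot (lattice T n)}) g) @` [set` tile T n])).
  move=> q _; exists (repr q - corner T n (repr q)); first exact: sub_corner_tile.
  rewrite -[RHS]reprK; apply/pi_eqP.
  by rewrite addrAC subrr add0r rpredN corner_lattice.
by apply: finite_image; exact: finite_fset.
Qed.

Definition lattice_scale : odometer_scale G :=
  OdometerScale lattice_finite (@lattice_decr G T).

End LatticeScale.

(** * Phases in the orbit closure and the factor map onto the odometer *)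

Section ArrayDynamics.
Local Open Scope quotient_scope.
Variables (G : zmodType) (T : tiling G) (k : nat) (L : labelling T k).
Local Notation lattice := (lattice T).
Local Notation tile := (tile T).
Local Notation corner := (corner T).
Let x : config G k := array L.
Local Notation X := (orbit_closure x).

(** With one existential per tile, the failure of [concat] is visible on a single tile, so [concat]
    is a closed condition. *)
Lemma concatP n (f : G -> 'I_k) :
  concat L n f <-> (forall c, c \in lattice n -> exists2 j, (j < nlab L n)%N &
    forall g, g \in tile n -> f (c + g) = desc L n j g :> nat).
Proof.
split=> [[l llt fE] c cn|H].
  exists (l c) => // g; rewrite tileP => /eqP g0.
  by rewrite fE descDl // cornerDl // g0 addr0.
have /choice[l lP] : forall c, exists j, (j < nlab L n)%N /\
    (c \in lattice n -> forall g, g \in tile n -> f (c + g) = desc L n j g :> nat).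
  move=> c; have [/H[j jlt jE]|_] := boolP (c \in lattice n); first by exists j.
  by exists 0%N; split=> //; exact: nlab_gt0.
exists l => [c|g]; first by have [] := lP c.
have cn := corner_lattice T n g.
have [_ /(_ cn _ (sub_corner_tile T n g))] := lP (corner n g).
by rewrite -(descDl L _ _ cn) addrCA subrr addr0.
Qed.

Lemma not_concat_window n (f : G -> 'I_k) : ~ concat L n f ->
  exists E : {fset G}, forall f', (forall g, g \in E -> f' g = f g) ->
    ~ concat L n f'.
Proof.
move=> /concatP /existsNP[c /not_implyP[cn H]].
exists [fset (c + g)%R | g in tile n]%fset => f' f'f /concatP /(_ c cn)[j jlt jE].
apply: H; exists j => // g gt; rewrite -jE // f'f //.
by apply/imfsetP; exists g.
Qed.

Lemma concat_eq n (f f' : G -> 'I_k) : f =1 f' -> concat L n f -> concat L n f'.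
Proof. by move=> /funext ->. Qed.

Lemma concat_offset n (f : G -> 'I_k) c c' : c' - c \in lattice n ->
  concat L n (fun g => f (c + g)) -> concat L n (fun g => f (c' + g)).
Proof.
move=> cc' /(concat_shift cc'); apply: concat_eq => g.
by rewrite addrA addrCA subrr addr0.
Qed.

Lemma array_offset n h : exists2 c, c \in tile n &
  concat L n (fun g => x (c + g + h)).
Proof.
exists (- h - corner n (- h)); first exact: sub_corner_tile.
have cn : - corner n (- h) \in lattice n by rewrite rpredN corner_lattice.
apply: concat_eq (concat_shift cn (array_concat L n)) => g.
congr (array L _); rewrite [RHS]addrAC; congr (_ + _).
by rewrite addrAC addNr add0r.
Qed.

(** Only the finitely many phases in [tile n] compete. If all failed, one finite window would refute
    them together, but some translate of [x] agrees with [z] there and has a phase. *)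
Lemma concat_ex n (z : config G k) : closure (shift_orbit x) z ->
  exists2 c, c \in tile n & concat L n (fun g => z (c + g)).
Proof.
move=> /orbit_closureP Xz; apply: contrapT => H.
have /choice[W WP] : forall c, exists E : {fset G}, c \in tile n ->
    forall z' : config G k, (forall g, g \in E -> z' g = z g) ->
    ~ concat L n (fun g => z' (c + g)).
  move=> c; have [ct|] := boolP (c \in tile n); last by exists fset0.
  have /not_concat_window[E EP] : ~ concat L n (fun g => z (c + g)).
    by move=> zc; apply: H; exists c.
  exists [fset (c + g)%R | g in E]%fset => _ z' z'z; apply: EP => g gE.
  by apply: z'z; apply/imfsetP; exists g.
have [h hP] := Xz (\bigcup_(c <- tile n) W c)%fset.
have [c ct] := array_offset n h.
apply: (WP c ct (fun g => x (g + h))) => g gW; apply: hP.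
by apply/bigfcupP; exists c; rewrite ?ct.
Qed.

(** Both phases are compared with one of level [n.+1], since [concat_lattice] consumes a level. *)
Lemma concat_uniq n (z : config G k) c c' : closure (shift_orbit x) z ->
  concat L n (fun g => z (c + g)) -> concat L n (fun g => z (c' + g)) ->
  c' - c \in lattice n.
Proof.
move=> /(@concat_ex n.+1)[c1 _ zc1].
have aux b : concat L n (fun g => z (b + g)) -> b - c1 \in lattice n.
  move=> zb; apply: (concat_lattice zc1); apply: concat_eq zb => g.
  by rewrite addrA addrCA subrr addr0.
move=> /aux cc1 /aux c'c1.
by rewrite -(subrK c1 c') -addrA -(opprB c c1) rpredB.
Qed.

(** The phase is locally constant: a finite window refutes every phase in [tile n] not congruent to
    [c], and a phase must exist. *)
Lemma concat_open n (z : config G k) c : closure (shift_orbit x) z ->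
  concat L n (fun g => z (c + g)) ->
  exists E : {fset G}, forall z' : config G k, closure (shift_orbit x) z' ->
    (forall g, g \in E -> z' g = z g) -> concat L n (fun g => z' (c + g)).
Proof.
move=> Xz zc.
have /choice[W WP] : forall b, exists E : {fset G}, b - c \notin lattice n ->
    forall z' : config G k, (forall g, g \in E -> z' g = z g) ->
    ~ concat L n (fun g => z' (b + g)).
  move=> b; have [bc|bc] := boolP (b - c \in lattice n); first by exists fset0.
  have /not_concat_window[E EP] : ~ concat L n (fun g => z (b + g)).
    by move=> /(concat_uniq Xz zc); apply/negP.
  exists [fset (b + g)%R | g in E]%fset => _ z' z'z; apply: EP => g gE.
  by apply: z'z; apply/imfsetP; exists g.
exists (\bigcup_(b <- tile n) W b)%fset => z' Xz' z'z.
have [b bt z'b] := concat_ex n Xz'.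
apply: (concat_offset _ z'b); rewrite -opprB rpredN.
apply: contrapT => /negP bc; apply: (WP b bc z' _ z'b) => g gW; apply: z'z.
by apply/bigfcupP; exists b; rewrite ?bt.
Qed.

Lemma in_array_closure (z : X) : closure (shift_orbit x) (val z).
Proof. exact: (set_mem (svalP z)). Qed.

Arguments in_array_closure : clear implicits.

(** A chosen phase, meaningful only modulo [lattice n]. *)
Definition offset n (z : X) : G := s2val (cid2 (concat_ex n (in_array_closure z))).

Lemma offsetP n z : concat L n (fun g => val z (offset n z + g)).
Proof. exact: (s2valP' (cid2 (concat_ex n (in_array_closure z)))). Qed.

Lemma offsetE n z c : concat L n (fun g => val z (c + g)) <->
  c - offset n z \in lattice n.
Proof.
split=> [zc|/concat_offset]; first exact: (concat_uniq (in_array_closure z)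
  (offsetP n z)).
by apply; exact: offsetP.
Qed.

Lemma offset_down n z : offset n.+1 z - offset n z \in lattice n.
Proof. by apply/offsetE/concat_down/offsetP. Qed.

Lemma offset_act n g z : offset n (act X g z) + g - offset n z \in lattice n.
Proof.
apply/offsetE; apply: concat_eq (offsetP n (act X g z)) => h.
by rewrite val_act -addrA (addrC h) addrA.
Qed.

(** Acting by [g] lowers the offset by [g]; the minus sign turns this into equivariance. *)
Definition phase (z : X) : quot_prod (lattice_scale T) :=
  fun n => \pi_({quot (lattice n)}) (- offset n z).

Lemma phase_limit z : inverse_limit (phase z).
Proof.
move=> n; rewrite /phase (@quot_transE _ (lattice_scale T)); apply/pi_eqP.
by rewrite opprK addrC -opprB rpredN offset_down.
Qed.

Definition phase_map (z : X) : odometer (lattice_scale T) :=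
  exist _ (phase z) (mem_set (phase_limit z)).

Lemma phase_map_eqP z z' n :
  val (phase_map z) n = val (phase_map z') n <->
  offset n z - offset n z' \in lattice n.
Proof.
rewrite /= /phase; split=> [/pi_eqP|zz'].
  by rewrite opprK addrC -opprB rpredN.
by apply/pi_eqP; rewrite opprK addrC -opprB rpredN.
Qed.

Lemma phase_factor_map : factor_map phase_map.
Proof.
apply: odometer_factor_map => [|g z].
  apply: odometer_continuous => z n.
  have [E EP] := concat_open (in_array_closure z) (offsetP n z).
  apply/orbit_nbhsP; exists E => z' z'z; apply/phase_map_eqP.
  rewrite -opprB rpredN; apply/offsetE.
  exact: (EP _ (in_array_closure z') z'z).
apply: odometer_eq => n /=; rewrite /phase /quot_act -raddfD; apply/pi_eqP.
by rewrite -rpredN opprB opprK addrAC (addrC g) offset_act.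
Qed.

Lemma phase_window n (z : X) g : offset n.+1 z \in lattice n.+1 ->
  g \in tile n -> val z g = x g.
Proof.
move=> z0; rewrite tileP => /eqP g0; apply: concat_array g0.
suff : concat L n.+1 (fun g => val z (0 + g)) by apply: concat_eq => h;
  rewrite add0r.
by apply/offsetE; rewrite sub0r rpredN.
Qed.

Lemma offset_zero n (z : X) : offset n (act X (offset n z) z) \in lattice n.
Proof. by have := offset_act n (offset n z) z; rewrite addrK. Qed.

Lemma array_minimal : minimal X.
Proof.
move=> z U [y Uy] oU.
have /orbit_nbhsP[E EU] : nbhs y U by exact: open_nbhs_nbhs.
have [h hP] := (orbit_closureP x (val y)).1 (in_array_closure y) E.
have [n nE] := tile_window T [fset (e + h)%R | e in E]%fset.
(* The offset brings [z] to phase zero, where it agrees with [x] on [tile n]; [h] then moves to the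
   place where [x] shows the pattern of [y] on [E]. *)
exists (act X (h + offset n.+1 z) z); split; last by exists (h + offset n.+1 z).
apply: EU => g gE; rewrite -(hP _ gE) actD val_act;
  apply: (phase_window (offset_zero _ _)).
by apply: (fsubsetP nE); apply/imfsetP; exists g.
Qed.

Lemma array_toeplitz : toeplitz x.
Proof.
move=> g; have [n gn] := tile_exhaust T g.
(* One level above the tile containing [g]: block 0 of level [n] recurs only along the lattice of
   level [n.+1]. *)
exists (lattice_scale T n.+1); first exact: scale_finite.
move=> c cn; rewrite addrC; apply/ord_inj.
rewrite (concat_pinned (array_concat L n.+1) cn gn).
by rewrite (arrayE L gn).
Qed.

(* Two points with the same phase are proximal, both being moved by a common
   translation near [x], and an equicontinuous factor identifies them. *)
Lemma phase_equicontinuous (Z : tds G) (q : X -> Z) z z' :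
  equicontinuous_tds Z -> factor_map q -> phase_map z = phase_map z' -> q z = q z'.
Proof.
move=> eqZ [qc _ qe] zz'; pose x0 : X := point.
apply: (@tds_hausdorff _ Z) => A B /nbhsP[E1 eE1 EA] /nbhsP[E2 eE2 EB].
pose E := E1 `&` E2.
have eE : entourage E by exact: filterI.
pose V := split_ent E `&` (split_ent E)^-1%relation.
have eV : entourage V.
  by apply: filterI; [|apply: entourage_inv]; exact: entourage_split_ent.
have /qc := eqZ (q x0) _ eV.
move=> /orbit_nbhsP[W WP].
have [n nW] := tile_window T W.
pose g := offset n.+1 z.
(* [act X g y] agrees with [x] on [tile n], and equicontinuity keeps the images close after [g] is
   undone. [V] is symmetric so that the estimates for [z] and [z'] compose. *)
have near_x y : offset n.+1 y - g \in lattice n.+1 -> V (act Z (- g) (q x0), q y).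
  move=> yg; rewrite -[q y](act0 (t := Z)) -(addNr g) actD -(qe g y).
  apply: (WP (act X g y) _ (- g) I) => h hW.
  apply: (@phase_window n); last exact: (fsubsetP nW).
  rewrite -(subrK (offset n.+1 y - g) (offset _ _)) rpredD //.
  by rewrite opprB addrA offset_act.
have [] := (near_x z _, near_x z' _).
  by rewrite subrr rpred0.
  by apply/phase_map_eqP; rewrite zz'.
move=> [_ /= Vz] [Vz' _].
exists (q z'); split; last first.
  by apply: EB; apply/mem_set; apply: entourage_refl.
apply: EA; apply/mem_set.
by have [] : E (q z, q z') by apply: (subset_split_ent eE);
  exists (act Z (- g) (q x0)).
Qed.

Lemma array_max_equicontinuous_factor :
  is_max_equicontinuous_factor X (odometer (lattice_scale T)).
Proof.
split; first exact: odometer_equicontinuous.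
exists phase_map; first exact: phase_factor_map.
move=> Z q eqZ fq; have [pc ps pe] := phase_factor_map; have [qc qs qe] := fq.
(* An arbitrary section: [q] is constant on the fibres of [phase_map], so the composite with [q]
   does not depend on the choice. *)
have [r rP] := choice ps.
have rE z : r (phase_map z) = r (phase_map z) by [].
have qr z : q z = q (r (phase_map z)).
  by apply: phase_equicontinuous => //; rewrite rP.
exists (q \o r) => //; split=> [|y|g y] /=.
(* Although [r] need not be continuous, preimages of closed sets are images under [phase_map] of
   compact sets. *)
- apply/continuous_closedP => C cC.
  have -> : (q \o r) @^-1` C = phase_map @` (q @^-1` C).
    apply/seteqP; split=> [y Cy|_ [z Cz <-]]; first by exists (r y).
    by rewrite /preimage /= -qr.
  apply: compact_closed; first exact: (@tds_hausdorff _ (odometer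
    (lattice_scale T))).
  apply: continuous_compact; first exact: continuous_subspaceT.
  apply: (subclosed_compact _ (@tds_compact _ X)) => //.
  by move/continuous_closedP: qc; apply.
- by have [z zy] := qs y; exists (phase_map z); rewrite -qr.
- by rewrite -qe (qr (act X g (r y))) pe rP.
Qed.

End ArrayDynamics.
Arguments in_array_closure {G T k} L z.

(** * Entropy *)

Section Logarithm.
Variable R : realType.
Implicit Types x y : R.

Lemma ln_le_sub1 y : 0 < y -> ln y <= y - 1.
Proof.
move=> y0; have : -1 < y - 1 by lra.
by move=> /le_ln1Dx; rewrite addrC subrK.
Qed.

Lemma ln_natr_ge0 n : 0 <= ln (n%:R : R).
Proof.
case: n => [|n]; first by rewrite ln0.
by rewrite ln_ge0 // ler1n.
Qed.

Lemma ler_ln_nat m n : (m <= n)%N -> ln (m%:R : R) <= ln n%:R.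
Proof.
case: m => [|m] mn; first by rewrite ln0 // ln_natr_ge0.
by rewrite ler_ln ?posrE ?ltr0n ?ler_nat //; case: n mn.
Qed.

(** Gibbs' inequality with unnormalized [q] of sum [Q]: apply [ln y <= y - 1] at
    [y = q s / (p s * Q)] and average over [p]. *)
Lemma gibbs (A : finType) (p q : A -> R) : (forall s, 0 <= p s) ->
  (forall s, 0 <= q s) -> (forall s, p s != 0 -> 0 < q s) -> \sum_s p s = 1 ->
  \sum_s p s * (ln (q s) - ln (p s)) <= ln (\sum_s q s).
Proof.
move=> p0 q0 pq p1.
have [s ps] : exists s, p s != 0.
  apply: contrapT => H; have : \sum_s p s = 0 by apply: big1 => s _;
    apply/eqP/negPn/negP => ps; apply: H; exists s.
  by rewrite p1 => /eqP; rewrite oner_eq0.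
pose Q := \sum_s q s; have Q0 : 0 < Q.
  rewrite /Q (bigD1 s) //=; apply: (@lt_le_trans _ _ (q s)); first exact: pq.
  by rewrite lerDl sumr_ge0.
suff : \sum_s (p s * (ln (q s) - ln (p s)) - p s * ln Q) <= \sum_s (q s / Q - p s).
  rewrite !sumrB -!mulr_suml p1 -/Q divff ?gt_eqF // mul1r; lra.
apply: ler_sum => t _; have [->|pt] := eqVneq (p t) 0.
  by rewrite !mul0r !subr0 divr_ge0 // ltW.
have pt0 : 0 < p t by rewrite lt_def pt p0.
have qt0 := pq _ pt.
have pQ : 0 < q t / (p t * Q) by rewrite divr_gt0 // mulr_gt0.
have := ln_le_sub1 pQ; rewrite ln_div ?posrE ?mulr_gt0 // lnM ?posrE //.
move=> /(ler_wpM2l (ltW pt0)).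
have -> : p t * (q t / (p t * Q) - 1) = q t / Q - p t.
  by field; rewrite !gt_eqF.
by move=> /(le_trans _); apply; rewrite -mulrBr; lra.
Qed.

End Logarithm.

(** * Entropy weights behind Shearer's inequality *)

Section Shearer.
Variables (R : realType) (D A : finType).
Implicit Types (F E : {set D}) (W : {set {ffun D -> A}}).

(** Masking with [None] gives traces on different [F] the same type. *)
Definition restrict F (w : {ffun D -> A}) : {ffun D -> option A} :=
  [ffun i => if i \in F then Some (w i) else None].

Definition traces F W : {set {ffun D -> option A}} :=
  [set restrict F w | w in W]%SET.

Lemma traces_gt0 F W : W != finset.set0 -> (0 < #|traces F W|)%N.
Proof.
by move=> /finset.set0Pn[w wW]; apply/card_gt0P; exists (restrict F w);
  exact: imset_f.
Qed.

(* Conditioning on one coordinate at a time, [a i] is the conditional entropy of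
   the coordinate [i] given the previous ones. *)
Lemma entropy_weights E W : W != finset.set0 ->
  (forall w w', w \in W -> w' \in W -> forall i, i \notin E -> w i = w' i) ->
  exists a : D -> R, \sum_(i in E) a i = ln #|W|%:R /\
    forall F, \sum_(i in F :&: E) a i <= ln #|traces F W|%:R.
Proof.
have [n] := ubnP #|E|; elim: n E W => // n IH E W En W0 agree.
have [E0|[i0 i0E]] := set_0Vmem E.
  exists (fun=> 0); split; last by move=> F; rewrite big1 // ln_natr_ge0.
  rewrite E0 big_set0; suff -> : #|W| = 1%N by rewrite ln1.
  have [w wW] := finset.set0Pn _ W0.
  apply/eqP/cards1P; exists w; apply/setP => w'; rewrite inE.
  apply/idP/eqP => [w'W|->//]; apply/ffunP => i; apply: agree => //.
  by rewrite E0 inE.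
(* Words in one slice also agree at [i0], so the induction hypothesis applies to the slice and
   [E :\ i0]. *)
pose Ws s := [set w in W | w i0 == s]%SET.
have WsW s : Ws s \subset W by apply/fintype.subsetP => w; rewrite inE => /andP[].
have /choice[a aP] : forall s, exists a : D -> R, Ws s != finset.set0 ->
    \sum_(i in E :\ i0) a i = ln #|Ws s|%:R /\
    forall F, \sum_(i in F :&: (E :\ i0)) a i <= ln #|traces F (Ws s)|%:R.
  move=> s; have [_|Ws0] := eqVneq (Ws s) finset.set0; first by exists (fun=> 0).
  have [||a aP] := IH (E :\ i0) (Ws s) _ Ws0.
  - by move: En; rewrite (cardsD1 i0 E) i0E add1n ltnS.
  - move=> w w'; rewrite !inE => /andP[wW /eqP ws] /andP[w'W /eqP w's] i.
    rewrite !inE negb_and negbK => /orP[/eqP ->|]; first by rewrite ws.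
    exact: agree.
  by exists a.
have cW : (0 < #|W|%:R :> R) by rewrite ltr0n card_gt0.
pose p s : R := #|Ws s|%:R / #|W|%:R.
have p0 s : 0 <= p s by rewrite divr_ge0 // ler0n.
have pW s : p s != 0 -> Ws s != finset.set0.
  by apply: contraNN => /eqP Ws0; rewrite /p Ws0 cards0 mul0r.
have p1 : \sum_s p s = 1.
  rewrite -mulr_suml -natr_sum; suff -> : (\sum_s #|Ws s|)%N = #|W|.
    by rewrite divff // gt_eqF.
  rewrite -sum1_card (partition_big (fun w : {ffun D -> A} => w i0) predT) //=.
  by apply: eq_bigr => s _; rewrite -sum1_card; apply: eq_bigl => w; rewrite inE.
(* The weight of [i0] is the Shannon entropy of its letter for a uniform word of [W]; the other
   weights are averaged over the slices. *)
exists (fun i => if i == i0 then - \sum_s p s * ln (p s) else \sum_s p s * a s i).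
have sumE F : i0 \notin F -> \sum_(i in F)
   (if i == i0 then - \sum_s p s * ln (p s) else \sum_s p s * a s i) =
   \sum_s p s * \sum_(i in F) a s i.
  move=> i0F; under [RHS]eq_bigr do rewrite mulr_sumr.
  rewrite exchange_big /=; apply: eq_bigr => i iF; case: eqP => // ii0.
  by rewrite -ii0 iF in i0F.
have i0D F : i0 \notin F :&: (E :\ i0) by rewrite !inE eqxx andbF.
split.
  rewrite (big_setD1 i0) //= eqxx sumE ?setD11 // -sumrN -big_split /=.
  rewrite -[RHS]mul1r -[X in _ = X * _]p1 mulr_suml; apply: eq_bigr => s _.
  have [->|ps] := eqVneq (p s) 0; first by rewrite !mul0r oppr0 addr0.
  have Ws0 := pW _ ps.
  rewrite (aP _ Ws0).1 -mulrN -mulrDr; congr (_ * _).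
  by rewrite [ln (p s)]ln_div ?posrE ?ltr0n ?card_gt0 // opprB subrK.
move=> F.
have leF s : p s * \sum_(i in F :&: (E :\ i0)) a s i <= p s * ln #|traces F (Ws
  s)|%:R.
  have [->|/pW Ws0] := eqVneq (p s) 0; first by rewrite !mul0r.
  by rewrite ler_wpM2l // (aP _ Ws0).2.
(* If [i0] is outside [F], the traces of each slice are simply among those of [W]. *)
have [i0F|i0F] := boolP (i0 \in F); last first.
  have -> : F :&: E = F :&: (E :\ i0).
    apply/setP => i; rewrite !inE; case: eqP => [->|//].
    by rewrite (negbTE i0F).
  rewrite sumE // -[leRHS]mul1r -[X in _ <= X * _]p1 mulr_suml;
    apply: ler_sum => s _.
  apply: (le_trans (leF s)); rewrite ler_wpM2l //; apply: ler_ln_nat.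
  exact/subset_leq_card/imsetS.
rewrite (big_setD1 i0) ?inE ?i0F //= eqxx -finset.setIDA sumE //.
rewrite -sumrN -big_split /=.
(* Here the letter at [i0] is visible in a trace, so different slices have disjoint traces and their
   numbers add up; [gibbs] takes them as [q]. *)
apply: (@le_trans _ _ (\sum_s p s * (ln #|traces F (Ws s)|%:R - ln (p s)))).
  by apply: ler_sum => s _; have := leF s; rewrite mulrBr; lra.
apply: le_trans (gibbs p0 _ _ p1) _ => //.
  by move=> s /pW Ws0; rewrite ltr0n traces_gt0.
rewrite -natr_sum; apply: ler_ln_nat.
have disj s t : s != t -> [disjoint traces F (Ws s) & traces F (Ws t)]%B.
  move=> st; rewrite -finset.setI_eq0; apply/eqP/setP => r; rewrite !inE.
  apply/negP => /andP[/imsetP[w + ->] /imsetP[w' + /ffunP/(_ i0)]].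
  rewrite !inE !ffunE i0F => /andP[_ /eqP ws] /andP[_ /eqP w't] [].
  by rewrite ws w't => /eqP; exact/negP.
under eq_bigr do rewrite -sum1_card.
rewrite -(partition_disjoint_bigcup _ _ disj) sum1_card.
apply/subset_leq_card/finset.bigcupsP => s _; exact: imsetS.
Qed.

End Shearer.

(** * Sumsets and Folner sequences *)

Section Sumsets.
Variables (G : zmodType).
Implicit Types A B F : {fset G}.

Definition sumset A B : {fset G} := [fset (a + b)%R | a in A, b in B]%fset.

Lemma sumsetP A B g : reflect (exists2 a, a \in A & g - a \in B) (g \in sumset A B).
Proof.
apply: (iffP idP) => [/imfset2P[a aA [b bB ->]]|[a aA gB]].
  by exists a => //; rewrite addrAC subrr add0r.
by apply/imfset2P; exists a => //; exists (g - a) => //; rewrite addrC subrK.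
Qed.

Lemma card_sumset_ge A B : A != fset0 -> (#|` B| <= #|` sumset A B|)%N.
Proof.
move=> /fset0Pn[a aA]; pose C := [fset (a + b)%R | b in B]%fset.
have -> : #|` B| = #|` C| by rewrite card_imfset //; exact: addrI.
apply/fsubset_leq_card/fsubsetP => _ /imfsetP[b /= bB ->].
by apply/sumsetP; exists a => //; rewrite addrAC subrr add0r.
Qed.

Lemma card_bigfcup_le (I : Type) (K : choiceType) (s : seq I) (C : {fset K}) (f
  : I -> {fset K}) :
  (#|` C `|` \bigcup_(i <- s) f i|%fset <= #|` C| + \sum_(i <- s) #|` f i|)%N.
Proof.
have cardU (X Y : {fset K}) : (#|` X `|` Y|%fset <= #|` X| + #|` Y|)%N.
  by rewrite cardfsU leq_subr.
apply: (leq_trans (cardU _ _)); rewrite leq_add2l.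
elim: s => [|i s IH]; first by rewrite !big_nil cardfs0.
by rewrite !big_cons (leq_trans (cardU _ _)) // leq_add2l.
Qed.

Lemma card_sumset_le A B :
  (#|` sumset A B| <= #|` A| + \sum_(b <- B) #|` symdiff (translate b A) A|)%N.
Proof.
apply: leq_trans (card_bigfcup_le _ _ _).
apply/fsubset_leq_card/fsubsetP => _ /imfset2P[a aA [b bB ->]].
rewrite inE; have [//|/= nA] := boolP (a + b \in A).
apply/bigfcupP; exists b; first by rewrite bB.
rewrite !inE nA /=; apply/orP; left; apply/imfsetP; exists a => //=.
by rewrite addrC.
Qed.

Lemma folner_sumset (R : realType) (F : nat -> {fset G}) B (e : R) :
  folner R F -> 0 < e ->
  \forall n \near \oo, #|` sumset (F n) B|%:R <= (1 + e) * #|` F n|%:R.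
Proof.
move=> [F0 Fg] e0.
have cvgB : (\sum_(b <- B) (#|` symdiff (translate b (F n)) (F n)|%:R / #|` F
  n|%:R : R))
   @[n --> \oo] --> (\sum_(b <- B) (0 : R)).
  apply: cvg_big => [|b _]; last exact: Fg.
  by move=> x; exact: add_continuous.
rewrite big1 // in cvgB.
near=> n.
have Fn : 0 < #|` F n|%:R :> R by rewrite ltr0n cardfs_gt0.
apply: (@le_trans _ _ (#|` F n|%:R + \sum_(b <- B) #|` symdiff (translate b (F
  n)) (F n)|%:R)).
  by rewrite -natr_sum -natrD ler_nat card_sumset_le.
rewrite mulrDl mul1r lerD2l -ler_pdivrMr // mulr_suml.
apply: ltW; apply: le_lt_trans (ler_norm _) _.
by near: n; exact: cvgr0_norm_lt.
Unshelve. all: by end_near. Qed.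

(** The chain is [|B| <= |F n + B| <= (1 + 1) |F n|], the last step by [folner_sumset] with
    [e = 1]. *)
Lemma folner_card (R : realType) (F : nat -> {fset G}) B : folner R F ->
  \forall n \near \oo, (#|` B| <= 2 * #|` F n|)%N.
Proof.
move=> FF; near=> n.
rewrite -(ler_nat R) natrM; apply: (@le_trans _ _ #|` sumset (F n) B|%:R).
  by rewrite ler_nat card_sumset_ge // FF.1.
have -> : 2%:R = 1 + 1 :> R by rewrite -natr1.
by near: n; exact: folner_sumset.
Unshelve. all: by end_near. Qed.

End Sumsets.

Section ComplexityLower.
Variables (R : realType) (G : zmodType) (k : nat) (X : set (config G k)).
Hypothesis X_shift : forall g z, X z -> X (config_shift g z).

Definition patterns (M : {fset G}) : {set {ffun M -> 'I_k}} :=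
  [set B : {ffun M -> 'I_k} |
      `[< exists2 y, X y & forall m : M, y (val m) = B m >]]%SET.

Lemma patternsP (M : {fset G}) (B : {ffun M -> 'I_k}) :
  reflect (exists2 y, X y & forall m : M, y (val m) = B m) (B \in patterns M).
Proof. by rewrite inE; exact: asboolP. Qed.

Lemma complexityE (M : {fset G}) : complexity X M = #|patterns M|.
Proof. by []. Qed.

(** By shift invariance, a trace on the part of [E] inside the translate of [F] by [g] is a function
    of a pattern on [F]. *)
Lemma traces_complexity (E F : {fset G}) g :
  (#|traces [set e : E | (val e - g)%R \in F]%SET (patterns E)| <= complexity X
    F)%N.
Proof.
pose h (B : {ffun F -> 'I_k}) : {ffun E -> option 'I_k} :=
  [ffun e : E => if insub (val e - g) is Some f then Some (B f) else None].
apply: leq_trans (leq_imset_card h (patterns F)).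
apply/subset_leq_card/fintype.subsetP => _ /imsetP[w /patternsP[y Xy yw] ->].
apply/imsetP; exists [ffun f : F => y (val f + g)].
  apply/patternsP; exists (config_shift g y); first exact: X_shift.
  by move=> m; rewrite ffunE.
apply/ffunP => e; rewrite !ffunE inE; case: insubP => [f -> fE|/negbTE -> //].
by rewrite ffunE fE subrK yw.
Qed.

(* Sum the Shearer weights of [patterns E] over the translates of [F] meeting
   [E]: each point of [E] is covered exactly [#|F|] times. *)
Lemma complexity_sumset (E F : {fset G}) :
  #|` F|%:R * ln (complexity X E)%:R <=
  #|` sumset E [fset - f | f in F]%fset|%:R * ln (complexity X F)%:R :> R.
Proof.
have [->|W0] := eqVneq (complexity X E) 0%N.
  by rewrite ln0 // mulr0 mulr_ge0 // ?ler0n ?ln_natr_ge0.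
set K := sumset _ _; rewrite complexityE cards_eq0 in W0.
have [|a [aE aF]] := @entropy_weights R _ _ [set: E]%SET _ W0.
  by move=> w w' _ _ i; rewrite inE.
rewrite complexityE -aE.
have cnt (e : E) : count (fun g => val e - g \in F) K = #|` F|.
  rewrite -size_filter -(size_map (fun f => val e - f) F).
  apply/perm_size/uniq_perm.
  - by rewrite filter_uniq // fset_uniq.
  - by rewrite map_inj_uniq ?fset_uniq // => u v /subrI.
  move=> g; rewrite mem_filter; apply/andP/mapP => [[eg _]|[f fF ->]].
    by exists (val e - g) => //; rewrite opprB addrC subrK.
  rewrite opprB addrC subrK; split=> //; apply/sumsetP; exists (val e);
    first exact: valP.
  apply/imfsetP; exists f => //=; by rewrite addrAC subrr add0r.
have -> : #|` F|%:R * \sum_(i in [set: E]%SET) a i =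
    \sum_(g <- K) \sum_(i in [set e : E | val e - g \in F]%SET :&: [set:
      E]%SET) a i.
  rewrite mulr_sumr; under [RHS]eq_bigr do rewrite finset.setIT big_mkcond /=.
  rewrite exchange_big /=; apply: eq_big => [i|i _]; first by rewrite inE.
  under eq_bigr do rewrite inE.
  by rewrite -big_mkcond big_const_seq cnt iter_addr_0 mulr_natl.
rewrite -sum1_size natr_sum mulr_suml; apply: ler_sum => g _; rewrite mul1r.
apply: le_trans (aF _) _; apply: ler_ln_nat; exact: traces_complexity.
Qed.

Lemma complexity_lower (E : nat -> {fset G}) (h : R) (F : {fset G}) :
  folner R E -> (forall n, h * #|` E n|%:R <= ln (complexity X (E n))%:R) ->
  h * #|` F|%:R <= ln (complexity X F)%:R.
Proof.
move=> EF hE; apply/ler_addgt0Pr => e e0.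
set l := ln _.
have l0 : 0 <= l by exact: ln_natr_ge0.
(* The denominator is not [l], which may vanish; all that is needed is [e' * l <= e]. *)
pose e' := e / (l + 1).
have l1 : 0 < l + 1 by lra.
have e'0 : 0 < e' by rewrite divr_gt0.
have [n _ nP] := folner_sumset [fset - f | f in F]%fset EF e'0.
have En : 0 < #|` E n|%:R :> R by rewrite ltr0n cardfs_gt0 EF.1.
have := complexity_sumset (E n) F; rewrite -/l => H.
have H1 := ler_wpM2l (ler0n R #|` F|) (hE n).
have H2 := ler_wpM2r l0 (nP n (leqnn n)).
have e'l : e' * l <= e.
  rewrite /e' mulrAC ler_pdivrMr // ler_pM2l //; lra.
rewrite -(ler_pM2r En).
apply: (@le_trans _ _ ((1 + e') * #|` E n|%:R * l)).
  apply: le_trans _ (le_trans H H2).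
  by rewrite mulrAC mulrC.
by rewrite mulrAC (ler_wpM2r (ltW En)) // mulrDl mul1r lerD2l.
Qed.

End ComplexityLower.

Lemma card_bigcup_le (I K : finType) (F : I -> {set K}) :
  (#|(\bigcup_i F i)%SET| <= \sum_i #|F i|)%N.
Proof.
elim/big_rec2: _ => [|i m A _ IH]; first by rewrite cards0.
by rewrite (leq_trans (leq_card_setU _ _)) // leq_add2l.
Qed.

(** * Entropy of the array *)

Section ArrayEntropy.
Variables (G : zmodType) (T : tiling G) (k : nat) (L : labelling T k).
Local Notation lattice := (lattice T).
Local Notation tile := (tile T).
Local Notation corner := (corner T).
Let x : config G k := array L.
Let X := closure (shift_orbit x).

(** Every level-[n] block stands somewhere in the array, and [desc_inj] tells the blocks apart. *)
Lemma nlab_le_complexity n : (nlab L n <= complexity X (tile n))%N.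
Proof.
have /choice[s sP] : forall v, exists s, (v < nlab L n)%N ->
    forall g, corner n g = 0 -> x (s + g) = desc L n v g :> nat.
  move=> v; have [vn|_] := ltnP v (nlab L n); last by exists 0.
  by have [s _ sE] := concat_all_labels (array_concat L n.+1) vn; exists s.
pose p (v : 'I_(nlab L n)) : {ffun tile n -> 'I_k} := [ffun g => x (s v + val g)].
have pinj : injective p.
  move=> u v /ffunP puv; apply/ord_inj; apply: (@desc_inj _ T k L n) => // g g0.
  have gt : g \in tile n by rewrite tileP g0.
  have := puv [` gt]%fset; rewrite !ffunE /= => /(congr1 (@nat_of_ord _)).
  by rewrite !sP.
rewrite complexityE -[X in (X <= _)%N]card_ord -(card_imset predT pinj).
apply/subset_leq_card/fintype.subsetP => _ /imsetP[v _ ->].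
apply/patternsP; exists (config_shift (s v) x).
  by apply: orbit_closure_inv; exact: orbit_closure_self.
by move=> m; rewrite ffunE /config_shift addrC.
Qed.

(** The collar: [F + tile_diff n] contains every level-[n] tile that meets [F], whatever the
    phase. *)
Definition tile_diff n := sumset (tile n) [fset - g | g in tile n]%fset.

(** The tiles meeting [F] are disjoint and lie in [F + tile_diff n]. *)
Lemma card_corners n (F : {fset G}) c :
  (#|` [fset corner n (f - c) | f in F]%fset| * #|` tile n| <=
   #|` sumset F (tile_diff n)|)%N.
Proof.
set K := [fset _ | _ in _]%fset.
set S := sumset _ _.
pose f (p : K * tile n) : G := val p.1 + val p.2 + c.
have fS p : f p \in S.
  case: p => a v; have /imfsetP[g /= gF ag] := valP a.
  apply/sumsetP; exists g => //; apply/sumsetP; exists (val v); first exact: valP.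
  apply/imfsetP; exists (g - c - corner n (g - c)); first exact: sub_corner_tile.
  rewrite /f /= ag opprB -!addrA; congr (_ + _).
  by rewrite addrCA [val v + _]addrC subrK opprB.
have finj : injective (fun p => [` fS p]%fset).
  move=> [a u] [b v] /(congr1 val); rewrite /= /f /=.
  have /imfsetP[g /= _ ag] := valP a; have /imfsetP[g' /= _ bg'] := valP b.
  have := valP u; have := valP v; rewrite !tileP => /eqP v0 /eqP u0.
  move=> /addIr /[dup] E /(congr1 (corner n)).
  rewrite ag bg' (cornerDl _ (corner_lattice T n (g - c))) u0.
  rewrite (cornerDl _ (corner_lattice T n (g' - c))) v0 !addr0 -ag -bg' => ab.
  by move: E; rewrite ab => /addrI uv; congr (_, _); exact: val_inj.
by have := leq_card _ finj; rewrite card_prod -!cardfE.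
Qed.

(** A pattern on [F] is determined by a phase in [tile n] and the labels of the tiles meeting
    [F]. *)
Lemma complexity_le n (F : {fset G}) :
  (complexity X F <= #|` tile n| *
     nlab L n ^ (#|` sumset F (tile_diff n)| %/ #|` tile n|))%N.
Proof.
pose K c := [fset corner n (f - c) | f in F]%fset.
have kK (c : G) (f : F) : corner n (val f - c) \in K c.
  by apply/imfsetP; exists (val f) => //; exact: valP.
pose h (c : G) (l : {ffun K c -> 'I_(nlab L n)}) : {ffun F -> 'I_k} :=
  [ffun f : F => Ordinal (desc_lt (val f - c) (ltn_ord (l [` kK c f]%fset)))].
apply: (@leq_trans (\sum_(c : tile n) #|[set h (val c) l | l in predT]%SET|)).
  apply: leq_trans (card_bigcup_le _).
  apply/subset_leq_card/fintype.subsetP => B /patternsP[y Xy yB].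
  have [c ct [l llt lE]] := concat_ex n Xy.
  apply/finset.bigcupP; exists [` ct]%fset => //.
  apply/imsetP; exists [ffun g : K c => Ordinal (llt (val g))] => //.
  apply/ffunP => f; apply/ord_inj; rewrite ffunE /= ffunE /= -lE -yB.
  by rewrite addrC subrK.
rewrite [X in (_ <= X * _)%N]cardfE -sum_nat_const; apply: leq_sum => c _.
apply: leq_trans (leq_imset_card _ _) _.
rewrite cardT -cardE card_ffun card_ord -cardfE.
rewrite leq_pexp2l ?nlab_gt0 // leq_divRL ?card_corners //.
by rewrite cardfs_gt0; apply/fset0Pn; exists 0; exact: tile0n.
Qed.

Variables (R : realType) (h : R).
Hypotheses (tile_folner : folner R tile) (h_ge0 : 0 <= h).
Hypothesis tile_unbounded : forall b, exists n, (b <= #|` tile n|)%N.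
Hypothesis nlab_ge : forall n, h * #|` tile n|%:R <= ln (nlab L n)%:R.
Hypothesis nlab_le : forall e : R, 0 < e ->
  exists n, ln (nlab L n)%:R <= (h + e) * #|` tile n|%:R.

Lemma array_entropy : has_topological_entropy X h.
Proof.
move=> F FF; apply/cvgrPdist_le => e e0.
have lower n : h * #|` F n|%:R <= ln (complexity X (F n))%:R.
  apply: (complexity_lower _ _ tile_folner) => [g z|m].
    exact: orbit_closure_inv.
  apply: le_trans (nlab_ge m) _; exact/ler_ln_nat/nlab_le_complexity.
(* The estimate ends with [d + (h + d) (1 + d) <= h + d (h + 3)] for [d <= 1]: the errors come from
   the choice of phase, the number of labels and the collar of [F i]. *)
pose d := Num.min 1 (e / (h + 3)).
have h3 : 0 < h + 3 by have := h_ge0; lra.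
have d0 : 0 < d by rewrite lt_min ltr01 divr_gt0.
have d1 : d <= 1 by rewrite ge_min lexx.
have de : d * (h + 3) <= e by rewrite -ler_pdivlMr // ge_min lexx orbT.
have [n nle] := nlab_le d0.
have tn : 0 < #|` tile n|%:R :> R by rewrite ltr0n cardfs_gt0; apply/fset0Pn;
  exists 0; exact: tile0n.
pose lt := ln (#|` tile n|%:R : R).
have lt0 : 0 <= lt by exact: ln_natr_ge0.
(* The [F i] eventually have at least half the size of this tile, so the logarithm of the number of
   phases is at most [d * |F i|]. *)
have [m mlt] : exists m, 2 * (lt / d) <= #|` tile m|%:R.
  have [m mP] := tile_unbounded (Num.Def.trunc (2 * (lt / d))).+1.
  exists m; apply/ltW/(lt_le_trans (truncnS_gt _)).
  by rewrite ler_nat.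
near=> i.
have Fi : 0 < #|` F i|%:R :> R by rewrite ltr0n cardfs_gt0 FF.1.
have H1 : #|` sumset (F i) (tile_diff n)|%:R <= (1 + d) * #|` F i|%:R.
  by near: i; exact: folner_sumset.
have H2 : lt <= d * #|` F i|%:R.
  have : (#|` tile m| <= 2 * #|` F i|)%N by near: i; exact: (folner_card _ FF).
  rewrite -(ler_nat R) natrM => /(le_trans mlt).
  by rewrite ler_pM2l // ler_pdivrMr // mulrC.
rewrite distrC ger0_norm; last by rewrite subr_ge0 ler_pdivlMr.
rewrite lerBlDr ler_pdivrMr //.
set q := (#|` sumset (F i) (tile_diff n)| %/ #|` tile n|)%N.
have qle : q%:R * #|` tile n|%:R <= #|` sumset (F i) (tile_diff n)|%:R :> R.
  by rewrite -natrM ler_nat leq_trunc_div.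
apply: (@le_trans _ _ (lt + q%:R * ln (nlab L n)%:R)).
  apply: le_trans (ler_ln_nat R (complexity_le n (F i))) _.
  rewrite natrM lnM ?posrE ?ltr0n ?expn_gt0 ?nlab_gt0 //;
    last by rewrite -(ltr_nat R).
  by rewrite natrX lnXn ?ltr0n ?nlab_gt0 // mulr_natl.
have q0 : 0 <= q%:R :> R by exact: ler0n.
have H3 := ler_wpM2l q0 nle.
have hd : 0 <= h + d by rewrite addr_ge0 // ltW.
have H4 := ler_wpM2l hd (le_trans qle H1).
apply: (@le_trans _ _ (d * #|` F i|%:R + (h + d) * ((1 + d) * #|` F i|%:R))).
  by apply: lerD => //; apply: le_trans H3 _; rewrite mulrCA.
rewrite [X in _ + X]mulrA -mulrDl ler_pM2r //.
have dd : d * d <= d by rewrite ler_piMl // ltW.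
have -> : d + (h + d) * (1 + d) = h + d * (h + 2) + d * d by ring.
lra.
Unshelve. all: by end_near. Qed.

End ArrayEntropy.

(** * Unique ergodicity *)

Section Extension.
Variables (R : realType) (T : pointedType) (A B : set (set T)).
Hypotheses (A0 : A set0) (AU : setU_closed A) (AC : setC_closed A).
(** A countable disjoint union inside [A] has finitely many nonempty terms, so finite additivity
    already gives sigma-additivity on [A]. *)
Hypothesis A_compact : forall F : nat -> set T, (forall n, A (F n)) ->
  trivIset setT F -> A (\bigcup_n F n) ->
  exists N, forall n, (N <= n)%N -> F n = set0.
Variable l : set T -> R.
Hypotheses (l_ge0 : forall C, 0 <= l C) (l0 : l set0 = 0) (lT : l setT = 1).
Hypothesis lU : forall C D, A C -> A D -> C `&` D = set0 ->
  l (C `|` D) = l C + l D.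
Hypothesis AB : <<s A >> = <<s B >>.

Definition algebra_type : Type := T.
HB.instance Definition _ := Pointed.on algebra_type.
HB.instance Definition _ := @isAlgebraOfSets.Build default_measure_display
  algebra_type A A0 AU AC.

Definition algebra_content (C : set algebra_type) : \bar R := (l C)%:E.

Lemma content_bigcup (F : nat -> set T) n : (forall i,
  A (F i)) -> trivIset setT F ->
  A (\bigcup_(i < n) F i) /\ l (\bigcup_(i < n) F i) = \sum_(0 <= i < n) l (F i).
Proof.
move=> AF tF; elim: n => [|n [An ln]].
  by rewrite II0 bigcup_set0 big_geq.
rewrite bigcup_mkord big_ord_recr /= -bigcup_mkord; split; first exact: AU.
rewrite lU ?ln //; first by rewrite big_nat_recr.
rewrite setIC setI_bigcupr; apply: bigcup0 => i /= ni.
by move/trivIsetP : tF => /(_ n i I I); apply; rewrite gtn_eqF.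
Qed.

Let content0 : algebra_content set0 = 0%E.
Proof. by rewrite /algebra_content l0. Qed.

Let content_ge0 C : (0 <= algebra_content C)%E.
Proof. by rewrite lee_fin. Qed.

Let content_sigma_additive : semi_sigma_additive algebra_content.
Proof.
move=> F AF tF AUF; have [N NF] := A_compact AF tF AUF.
apply: cvg_near_cst; exists N => // n /= Nn.
rewrite /algebra_content sumEFin; congr (_%:E).
rewrite -(content_bigcup n AF tF).2; congr (l _).
apply/seteqP; split=> z [i iI Fiz]; exists i => //=.
by rewrite ltnNge; apply/negP => /(leq_trans Nn) /NF F0; rewrite F0 in Fiz.
Qed.

HB.instance Definition _ := isMeasure.Build _ _ _ algebra_content
  content0 content_ge0 content_sigma_additive.

(** The Caratheodory extension, retyped on the sigma-algebra generated by [B]; [AB] carries its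
    additivity over. *)
Definition generated_measure : set (g_sigma_algebraType B) -> \bar R :=
  measure_extension algebra_content.

Let generated0 : generated_measure set0 = 0%E.
Proof. exact: measure0. Qed.

Let generated_ge0 C : (0 <= generated_measure C)%E.
Proof. exact: measure_ge0. Qed.

Let generated_sigma_additive : semi_sigma_additive generated_measure.
Proof.
move=> F mF tF mUF; apply: measure_semi_sigma_additive => //.
  by move=> i; have := mF i; rewrite /measurable /= AB.
by move: mUF; rewrite /measurable /= AB.
Qed.

HB.instance Definition _ := isMeasure.Build _ _ _ generated_measure
  generated0 generated_ge0 generated_sigma_additive.

Lemma generated_measureE C : A C -> generated_measure C = (l C)%:E.
Proof. by move=> AC'; rewrite /generated_measure /measure_extension
  measurable_mu_extE. Qed.

Let generatedT : generated_measure setT = 1%E.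
Proof. by rewrite generated_measureE ?lT // -setC0; exact: AC. Qed.

HB.instance Definition _ := Measure_isProbability.Build _ _ _ generated_measure
  generatedT.

Lemma content_extension : exists P : probability (g_sigma_algebraType B) R,
  forall C, A C -> P C = (l C)%:E.
Proof. by exists generated_measure; exact: generated_measureE. Qed.

End Extension.

Section MeanLimit.
Variables (R : realType).

(* The invariant measure is a limit of visit frequencies along an ultrafilter,
   which spares proving that they converge. *)
Lemma ultra_mean : exists U : set_system nat, [/\ UltraFilter U,
  \oo `<=` U & forall u : nat -> R, (forall n, 0 <= u n <= 1) ->
    cvg (u n @[n --> U])].
Proof.
have [U [UU ooU]] := @ultraFilterLemma nat \oo _.
exists U; split=> // u u01.
have FU : ProperFilter (u n @[n --> U]) by exact: fmap_proper_filter.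
have [|p [_ clp]] := @segment_compact R 0 1 (u n @[n --> U]) FU.
  apply: (@filterS _ U _ setT); last exact: filterT.
  by move=> n _; rewrite /= in_itv /= u01.
apply/cvg_ex; exists p => V nV.
(* An ultrafilter contains a neighbourhood's preimage or its complement, and the latter contradicts
   the cluster point. *)
have [//|UV] := in_ultra_setVsetC (u @^-1` V) UU.
by have [y [nVy Vy]] := clp (~` V) V UV nV.
Qed.

End MeanLimit.

(** * Cylinder sets and existence of an invariant measure *)

Section LocalSets.
Variables (G : zmodType) (k : nat) (x : config G k).
Local Notation X := (orbit_closure x).
Implicit Types C : set X.

(** Membership is decided by a finite window; one implication is enough, as [z] and [z'] can be
    exchanged. *)
Definition local C := exists E : {fset G}, forall z z' : X,
  (forall g, g \in E -> val z g = val z' g) -> C z -> C z'.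

Lemma local0 : local set0.
Proof. by exists fset0. Qed.

Lemma localC : setC_closed local.
Proof.
move=> C [E EC]; exists E => z z' zz' nCz Cz'; apply: nCz.
by apply: EC Cz' => g gE; rewrite zz'.
Qed.

Lemma localU : setU_closed local.
Proof.
move=> C C' [E EC] [E' EC']; exists (E `|` E')%fset => z z' zz' [Cz|Cz].
  by left; apply: EC Cz => g gE; apply: zz'; rewrite inE gE.
by right; apply: EC' Cz => g gE; apply: zz'; rewrite inE gE orbT.
Qed.

Lemma localI : setI_closed local.
Proof.
move=> C C' lC lC'; rewrite -[_ `&` _]setCK setCI.
by apply: localC; apply: localU; exact: localC.
Qed.

Lemma localT : local setT.
Proof. by rewrite -setC0; apply: localC; exact: local0. Qed.

Lemma local_open C : local C -> open C.
Proof.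
move=> [E EC]; rewrite openE => z Cz; apply/orbit_nbhsP; exists E => z' z'z.
by apply: EC Cz => g /z'z.
Qed.

Lemma local_act g C : local C -> local (act X g @^-1` C).
Proof.
move=> [E EC]; exists [fset (e + g)%R | e in E]%fset => z z' zz'.
apply: EC => e eE; rewrite !val_act; apply: zz'.
by apply/imfsetP; exists e.
Qed.

(** Otherwise points [z N] in some [F n] with [n >= N] cluster at a [p]. Both each [F i] and the
    complement of the union are open, so [p] can be in neither. *)
Lemma local_compact (F : nat -> set X) : (forall n, local (F n)) ->
  trivIset setT F -> local (\bigcup_n F n) ->
  exists N, forall n, (N <= n)%N -> F n = set0.
Proof.
move=> lF tF lUF; apply: contrapT => H.
have /choice[z zP] : forall N, exists z : X, exists2 n, (N <= n)%N & F n z.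
  move=> N; apply: contrapT => NF; apply: H; exists N => n Nn.
  by apply/seteqP; split=> // z Fz; apply: NF; exists z; exists n.
have [|p [_ clp]] := @tds_compact _ X (z n @[n --> \oo]) _; first exact: filterT.
have [[i _ Fip]|nUp] := pselect ((\bigcup_n F n) p).
  have := clp [set y | exists2 n, (i.+1 <= n)%N & F n y] (F i).
  case=> [||y [[n ni Fny] Fiy]].
  - exists i.+1 => // n /= ni; have [m nm Fm] := zP n; exists m => //.
    exact: leq_trans nm.
  - by apply: open_nbhs_nbhs; split=> //; exact: local_open.
  - move/trivIsetP : tF => /(_ n i I I); rewrite gtn_eqF // => /(_ isT).
    by move=> /seteqP[/(_ y) + _]; apply.
have := clp (\bigcup_n F n) (~` \bigcup_n F n).
case=> [||y [Uy nUy]] //.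
- by exists 0%N => // n _; have [m _ Fm] := zP n; exists m.
- apply: open_nbhs_nbhs; split=> //; apply/local_open; exact: localC.
Qed.

Variable D : nat -> {fset G}.
Hypothesis D_cover : forall E : {fset G}, exists n, (E `<=` D n)%fset.

(** The [D n] are countably many windows exhausting the group, so an open set is a countable union
    of local ones. *)
Lemma sigma_local : <<s local >> = <<s @open X >>.
Proof.
apply/seteqP; split; apply: smallest_sub; try exact: smallest_sigma_algebra.
  by move=> C /local_open oC; exact: sub_sigma_algebra.
move=> C oC.
pose V n : set X := [set z | forall z' : X, (forall g,
  g \in D n -> val z' g = val z g) -> C z'].
have -> : C = \bigcup_n V n.
  apply/seteqP; split=> [z Cz|z [n _]]; last by apply.
  have /orbit_nbhsP[E EC] : nbhs z C by exact: open_nbhs_nbhs.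
  have [n nE] := D_cover E; exists n => // z' z'z; apply: EC => g gE.
  by apply: z'z; exact: (fsubsetP nE).
apply: sigma_algebra_bigcup => n; apply: sub_sigma_algebra.
exists (D n) => z z' zz' Vz y yz'; apply: Vz => g gD.
by rewrite yz' // zz'.
Qed.

Variable R : realType.

Lemma act_measurable g : measurable_fun setT (act X g : borel X -> borel X).
Proof.
apply: (@measurability _ _ (borel X) (borel X) setT (act X g) (@open X) erefl).
move=> _ [C oC <-]; rewrite setTI; apply: sub_sigma_algebra.
by move/continuousP: (@act_continuous _ X g); apply.
Qed.

Lemma local_measurable C : local C -> measurable (C : set (borel X)).
Proof. by move=> /local_open; exact: sub_sigma_algebra. Qed.

Lemma eq_local_measure (m1 m2 : {measure set (borel X) -> \bar R}) :
  (m1 setT < +oo)%E -> (forall C : set (borel X), local C -> m1 C = m2 C) ->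
  forall C : set (borel X), measurable C -> m1 C = m2 C.
Proof.
move=> m1T m12 C mC.
apply: (@measure_unique _ R (borel X) local (fun=> setT)) => //.
- by rewrite /measurable /= sigma_local.
- exact: localI.
- by move=> _; exact: localT.
- by rewrite bigcup_const //; exists 0%N.
Qed.

Definition pushforward_act (P : {measure set (borel X) -> \bar R}) g : {measure
  set (borel X) -> \bar R} :=
  measure_function_pushforward__canonical__measure_function_Measure P
    (act_measurable g).

Lemma invariant_local (P : probability (borel X) R) :
  (forall g (C : set (borel X)), local C -> P (act X g @^-1` C) = P C) ->
    invariant_measure P.
Proof.
move=> Pinv g C mC.
have := @eq_local_measure (pushforward_act P g) P _ _ C mC; apply.
  by rewrite /pushforward_act /= /pushforward preimage_setT probability_setT ltry.
by move=> C' lC'; exact: Pinv.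
Qed.

Hypothesis D_folner : folner R D.

Definition visits C n : {fset G} :=
  [fset g in D n | `[< C (act X g point) >]]%fset.

Definition visit_rate C n : R := #|` visits C n|%:R / #|` D n|%:R.

Let D_gt0 n : 0 < #|` D n|%:R :> R.
Proof. by rewrite ltr0n cardfs_gt0 D_folner.1. Qed.

Lemma visit_rate_itv C n : 0 <= visit_rate C n <= 1.
Proof.
rewrite divr_ge0 //= ler_pdivrMr // mul1r ler_nat.
by apply/fsubset_leq_card/fsubsetP => g; rewrite !inE => /andP[].
Qed.

Lemma visit_rateU C C' n : C `&` C' = set0 ->
  visit_rate (C `|` C') n = visit_rate C n + visit_rate C' n.
Proof.
move=> CC'; rewrite -mulrDl -natrD; congr (_%:R / _).
have -> : visits (C `|` C') n = (visits C n `|` visits C' n)%fset.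
  by apply/fsetP => g; rewrite !inE asbool_or andb_orr.
rewrite cardfsU; have -> : (visits C n `&` visits C' n)%fset = fset0.
  apply/fsetP => g; rewrite !inE; apply/negbTE/negP.
  move=> /andP[/andP[_ /asboolP Cg] /andP[_ /asboolP Cg']].
  by have : (C `&` C') (act X g point) by []; rewrite CC'.
by rewrite cardfs0 subn0.
Qed.

(** Visits to the preimage along [D n] are visits to [C] along its translate by [g]. *)
Lemma visit_rate_act g C n :
  `|visit_rate (act X g @^-1` C) n - visit_rate C n| <=
  #|` symdiff (translate g (D n)) (D n)|%:R / #|` D n|%:R.
Proof.
rewrite -mulrBl normrM [X in _ * X]ger0_norm ?invr_ge0 // ler_wpM2r ?invr_ge0 //.
pose V := [fset h in translate g (D n) | `[< C (act X h point) >]]%fset.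
have -> : #|` visits (act X g @^-1` C) n| = #|` V|.
  suff -> : V = [fset (g + h)%R | h in visits (act X g @^-1` C) n]%fset.
    by rewrite [RHS]card_imfset //; exact: addrI.
  apply/esym/fsetP => h; apply/imfsetP/idP => [[u + ->]|].
    rewrite !inE => /andP[uD Cu]; apply/andP; split; last by rewrite actD.
    by apply/imfsetP; exists u.
  rewrite !inE => /andP[/imfsetP[u /= uD ->] Cu]; exists u => //.
  rewrite !inE uD; move: Cu.
  by rewrite (_ : sub_act _ _ _ = act X g (act X u point)) // -actD.
have sub (A B S : {fset G}) : (A `\` B `<=` S)%fset -> #|` A|%:R - #|` B|%:R <=
  #|` S|%:R :> R.
  move=> /fsubset_leq_card AB; rewrite lerBlDl -natrD ler_nat.
  rewrite -(cardfsID B A); apply: leq_add => //.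
  exact/fsubset_leq_card/fsubsetIr.
rewrite ler_norml -[- _ <= _]lerN2 opprK opprB !sub //; apply/fsubsetP => h;
  rewrite !inE.
  by move: (h \in translate g (D n)) (h \in D n) `[< _ >] => [] [] [].
by move: (h \in translate g (D n)) (h \in D n) `[< _ >] => [] [] [].
Qed.

(** Krylov-Bogolyubov along the orbit of [x]: the ultralimit of visit rates is additive,
    [local_compact] makes it a measure, and the Folner property makes it invariant. *)
Lemma invariant_measure_exists : exists P : probability (borel X) R,
  invariant_measure P.
Proof.
have [U [UU ooU Ucvg]] := ultra_mean R.
pose l C := lim (visit_rate C n @[n --> U]).
have lC C : visit_rate C n @[n --> U] --> l C.
  by apply: Ucvg => n; exact: visit_rate_itv.
have l_eq C y : visit_rate C n @[n --> U] --> y -> l C = y.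
  by move=> Cy; apply: (@cvg_unique _ (@norm_hausdorff _ _) _ _ _ _ (lC C) Cy).
have [|||||P PE] := @content_extension R X local (@open X) local0 localU localC
  local_compact l.
- move=> C; apply: limr_ge; first exact: lC.
  by apply: filterE => n; have /andP[] := visit_rate_itv C n.
- apply: l_eq; rewrite (_ : visit_rate set0 = cst 0); first exact: cvg_cst.
  apply/funext => n; rewrite /visit_rate (_ : visits set0 n = fset0) ?cardfs0
    ?mul0r //.
  by apply/fsetP => g; rewrite !inE; apply/negbTE; rewrite negb_and; apply/orP;
    right; exact/asboolP.
- apply: l_eq; rewrite (_ : visit_rate setT = cst 1); first exact: cvg_cst.
  apply/funext => n; rewrite /visit_rate (_ : visits setT n = D n) ?divff
    ?gt_eqF //.
  by apply/fsetP => g; rewrite !inE asboolT // andbT.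
- move=> C C' _ _ CC'; apply: l_eq.
  rewrite (_ : visit_rate _ = fun n => visit_rate C n + visit_rate C' n).
    exact: cvgD.
  by apply/funext => n; exact: visit_rateU.
- exact: sigma_local.
exists P; apply: invariant_local => g C lCC; rewrite !PE //; last exact: local_act.
congr (_%:E); apply: l_eq.
rewrite (_ : visit_rate _ = fun n =>
  visit_rate C n + (visit_rate (act X g @^-1` C) n - visit_rate C n)); last first.
  by apply/funext => n; rewrite addrC subrK.
rewrite -[l C]addr0; apply: cvgD => //.
have diff0 : (visit_rate (act X g @^-1` C) n - visit_rate C n) @[n --> \oo] -->
  (0 : R).
  apply/norm_cvg0P; apply: squeeze_cvgr (D_folner.2 g); last exact: cvg_cst.
  by apply: nearW => n; rewrite normr_ge0 visit_rate_act.
by move=> V /diff0; exact: ooU.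
Qed.

End LocalSets.

Lemma tile_sum (G : zmodType) (T : tiling G) n (F : G -> nat) :
  (\sum_(g <- tile T n.+1) F g =
   \sum_(s <- subtiles T n) \sum_(u <- tile T n) F (s + u)%R)%N.
Proof.
have corner_su s u : s \in subtiles T n -> u \in tile T n ->
    corner T n (s + u) = s /\ corner T n.+1 (s + u) = 0.
  move=> sS; rewrite tileP => /eqP u0; have sL := subtile_lattice sS.
  have [s1 s2] := subtilesP _ _ _ sS.
  have su : corner T n (s + u) = s by rewrite cornerDl // u0 addr0.
  by rewrite su -corner_up su.
rewrite -(big_allpairs (F := fun p : G * G => F (p.1 + p.2))).
rewrite -(big_map (fun p : G * G => p.1 + p.2) xpredT F).
apply: perm_big; apply: uniq_perm; first exact: fset_uniq.
  rewrite map_inj_in_uniq => [|[s u] [s' u']].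
    by apply: allpairs_uniq; rewrite ?fset_uniq // => -[a b] [c d].
  move=> /allpairsP[[a b] /= [aS bT [-> ->]]] /allpairsP[[a' b'] /= [a'S b'T
    [-> ->]]].
  have [E _] := corner_su _ _ aS bT; have [E' _] := corner_su _ _ a'S b'T.
  move=> /= H; move: (E); rewrite H E' => aa'.
  by move: H; rewrite aa' => /addrI ->.
move=> g; apply/idP/mapP => [gT|[[s u] /allpairsP[[a b] /= [aS bT [-> ->]]]
  ->]]; last first.
  by rewrite /= tileP (corner_su _ _ aS bT).2.
exists (corner T n g, g - corner T n g) => /=; last by rewrite addrCA subrr addr0.
apply/allpairsP; exists (corner T n g, g - corner T n g); split=> //=;
  last exact: sub_corner_tile.
apply/subtilesP; rewrite corner_up corner_idem; split=> //.
by apply/eqP; rewrite -tileP.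
Qed.

Lemma card_fset_sep (K : choiceType) (A : {fset K}) (Q : pred K) :
  (#|` [fset s in A | Q s]%fset| = \sum_(s <- A) Q s)%N.
Proof.
rewrite card_fset_sum1 big_fset /= big_mkcond /=; apply: eq_bigr => s _.
by case: (Q s).
Qed.

(** * Visit frequencies and uniqueness of the invariant measure *)

Section UniqueErgodicity.
Variables (R : realType) (G : zmodType) (T : tiling G) (k : nat) (L : labelling
  T k).
Local Notation lattice := (lattice T).
Local Notation tile := (tile T).
Local Notation subtiles := (subtiles T).
Local Notation corner := (corner T).
Let x : config G k := array L.
Local Notation X := (orbit_closure x).
Hypothesis tile_folner : folner R tile.

Definition aligned n (c : G) : set X :=
  [set z | concat L n (fun g => val z (c + g))].

Lemma aligned_measurable n c : measurable (aligned n c : set (borel X)).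
Proof.
apply: sub_sigma_algebra; rewrite /= openE => z zc.
have [E EP] := concat_open (in_array_closure L z) zc.
apply/orbit_nbhsP; exists E => z' z'z; exact: (EP _ (in_array_closure L z') z'z).
Qed.

Lemma aligned_act n g c : act X g @^-1` (aligned n c) = aligned n (g + c).
Proof.
by apply/seteqP; split=> z; apply: concat_eq => h;
  rewrite val_act -addrA addrC -!addrA;
   congr (val z _); rewrite (addrC h) addrA.
Qed.

(** The sign is chosen so that pulling [aligned n (- c)] back by [act X c] gives [aligned n 0]. *)
Lemma aligned_cover n : \big[setU/set0]_(c <- tile n) aligned n (- c) = setT.
Proof.
apply/seteqP; split=> // z _.
rewrite -bigcup_fset.
exists (- offset n z - corner n (- offset n z)); first exact: sub_corner_tile.
by apply/(offsetE n z); rewrite opprB opprK addrK corner_lattice.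
Qed.

Lemma aligned_disjoint n : trivIset [set` tile n] (fun c => aligned n (- c)).
Proof.
move=> c c'; rewrite /= !tileP => /eqP c0 /eqP c'0 [z [zc zc']].
have := concat_uniq (in_array_closure L z) zc zc'.
rewrite opprK addrC => cL; apply/eqP; rewrite -subr_eq0; apply/eqP.
have := cornerDr c' cL; rewrite addrCA subrr addr0 c0 c'0 add0r => <-.
by [].
Qed.

Definition visit_count n (C : set X) (z : X) : nat :=
  (\sum_(g <- tile n) `[< C (act X g z) >])%N.

(** Cut [C] by phase and pull the piece at phase [- c] back by [act X c]: invariance keeps its mass,
    and all pieces now lie over [aligned n 0]. *)
Lemma aligned_mass n (P : probability (borel X) R) (C : set (borel X)) :
  invariant_measure P -> measurable C ->
  P C = (\int[P]_(z in aligned n 0) ((visit_count n C z)%:R : R)%:E)%E.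
Proof.
move=> Pinv mC.
have mI c : measurable ((act X c @^-1` C) : set (borel X)).
  by rewrite -[_ @^-1` _]setTI; exact: act_measurable.
have -> : P C = (\sum_(c <- tile n) P (C `&` aligned n (- c)))%E.
  rewrite -measure_fbigsetU.
  - by rewrite -big_distrr /= aligned_cover setIT.
  - by move=> c _; apply: measurableI => //; exact: aligned_measurable.
  - by apply: trivIset_setIl; exact: aligned_disjoint.
have aE c : P (C `&` aligned n (- c)) = (\int[P]_(z in aligned n 0) (\1_(act X
  c @^-1` C) z)%:E)%E.
  rewrite integral_indic //; last exact: aligned_measurable.
  rewrite -(Pinv c) ?preimage_setI ?aligned_act ?subrr //.
  by apply: measurableI => //; exact: aligned_measurable.
under eq_bigr do rewrite aE.
rewrite -ge0_integral_sum //.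
- apply: eq_integral => z _; rewrite sumEFin natr_sum; congr (_%:E).
- exact: aligned_measurable.
- by move=> c; apply/measurable_EFinP; exact: measurable_indic.
Qed.

Section LocalFrequency.
Variables (C : set X) (E : {fset G}).
Hypothesis E_local : forall z z' : X,
  (forall g, g \in E -> val z g = val z' g) -> C z -> C z'.
Variable n : nat.

Definition inner (u : G) : bool := ([fset (e + u)%R | e in E] `<=` tile n)%fset.

Definition boundary : nat := (\sum_(u <- tile n) ~~ inner u)%N.

(* For [g] and all of [g + E] in one level-[n] tile, whether [act X g z] is in [C]
   depends only on the label of that tile, and every label occurs equally often
   in all level-[n.+1] tiles. *)
Lemma visit_count_bounds : exists A : nat, forall z, aligned n.+1 0 z ->
  (A <= visit_count n.+1 C z <= A + #|` subtiles n| * boundary)%N.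
Proof.
(* [w v] shows block [v] on [tile n] and stands in for every tile with that label. *)
have /choice[w wP] : forall v, exists w : X, (v < nlab L n)%N ->
    forall g, g \in tile n -> val w g = desc L n v g :> nat.
  move=> v; have [vn|_] := ltnP v (nlab L n); last by exists point.
  have [s _ sE] := concat_all_labels (array_concat L n.+1) vn.
  exists (act X s point) => _ g; rewrite tileP => /eqP g0.
  by rewrite val_act addrC -sE.
pose occ v := (\sum_(u <- tile n) inner u * `[< C (act X u (w v)) >])%N.
pose A j := (\sum_(s <- subtiles n) occ (word L n j s))%N.
(* Grouping the subtiles by label leaves only the composition of the word, which [word_type] makes
   independent of [j]. *)
have AE j : (j < nlab L n.+1)%N -> A j = A 0%N.
  move=> jn; have AA i : (i < nlab L n.+1)%N -> A i =
      (\sum_(v < nlab L n) #|` [fset s in subtiles n | word L n i s == v]%fset|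
        * occ v)%N.
    move=> ilt; rewrite /A; pose W s := Ordinal (word_lt s ilt).
    rewrite (eq_bigr (fun s => \sum_(v < nlab L n | v == W s) occ v)%N); last first.
      by move=> s _; rewrite big_pred1_eq.
    under eq_bigr do rewrite big_mkcond.
    rewrite exchange_big /=; apply: eq_bigr => v _.
    rewrite card_fset_sep big_distrl /=; apply: eq_bigr => s _.
    by rewrite -val_eqE /= eq_sym; case: eqP; rewrite ?mul1n ?mul0n.
  by rewrite !AA ?nlab_gt0 //; apply: eq_bigr => v _;
    rewrite (word_type v jn (nlab_gt0 L _)).
exists (A 0%N) => z zal; have [l llt lE] := zal.
rewrite -(AE _ (llt 0)) /visit_count tile_sum.
have key s u : s \in subtiles n -> u \in tile n -> inner u ->
    `[< C (act X (s + u) z) >] = `[< C (act X u (w (word L n (l 0) s))) >].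
  move=> sS uT /fsubsetP uE; have sL := subtile_lattice sS.
  have [s1 s2] := subtilesP _ _ _ sS.
  have agree e : e \in E -> val (act X (s + u) z) e =
      val (act X u (w (word L n (l 0) s))) e.
    move=> eE; apply/ord_inj; rewrite !val_act.
    have eu : e + u \in tile n by apply: uE; apply/imfsetP; exists e.
    rewrite (wP _ (word_lt s (llt 0)) _ eu) addrCA.
    have := lE (s + (e + u)); rewrite add0r => ->.
    move: eu; rewrite tileP => /eqP eu0.
    have seu : corner n (s + (e + u)) = s by rewrite cornerDl // eu0 addr0.
    have seu1 : corner n.+1 (s + (e + u)) = 0 by rewrite -corner_up seu.
    by rewrite seu1 /= seu seu1 subr0 descDl.
  by apply/asboolP/asboolP; apply: E_local => e eE; rewrite agree.
have le1 s u : s \in subtiles n -> u \in tile n ->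
    (inner u * `[< C (act X u (w (word L n (l 0%R) s))) >] <= `[< C (act X (s +
      u) z) >] <=
     inner u * `[< C (act X u (w (word L n (l 0%R) s))) >] + ~~ inner u)%N.
  move=> sS uT; have [iu|_] := boolP (inner u).
    by rewrite (key _ _ sS uT iu) mul1n addn0 leqnn.
  by rewrite mul0n /= leq_b1.
apply/andP; split.
  rewrite /A big_seq [X in (_ <= X)%N]big_seq; apply: leq_sum => s sS.
  rewrite /occ big_seq [X in (_ <= X)%N]big_seq; apply: leq_sum => u uT.
  by have /andP[] := le1 _ _ sS uT.
rewrite card_fset_sum1 big_distrl /= /A -big_split /=.
rewrite big_seq [X in (_ <= X)%N]big_seq; apply: leq_sum => s sS.
rewrite mul1n /occ /boundary -big_split /=.
rewrite big_seq [X in (_ <= X)%N]big_seq; apply: leq_sum => u uT.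
by have /andP[] := le1 _ _ sS uT.
Qed.

End LocalFrequency.

Lemma card_tileS n : #|` tile n.+1| = (#|` subtiles n| * #|` tile n|)%N.
Proof.
rewrite !card_fset_sum1 (tile_sum T n) big_distrl /=; apply: eq_bigr => s _.
by rewrite mul1n.
Qed.

Let tile_gt0 n : 0 < #|` tile n|%:R :> R.
Proof. by rewrite ltr0n cardfs_gt0 tile_folner.1. Qed.

Lemma aligned_measure n (P : probability (borel X) R) : invariant_measure P ->
  P (aligned n 0) = (#|` tile n|%:R^-1)%:E.
Proof.
move=> Pinv; have := aligned_mass n Pinv measurableT.
rewrite probability_setT.
rewrite (_ : (fun z => _) = cst (#|` tile n|%:R)%:E); last first.
  apply/funext => z; rewrite /visit_count card_fset_sum1; congr (_%:R%:E).
  by apply: eq_bigr => g _; rewrite asboolT.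
rewrite integral_cst; last exact: aligned_measurable.
move=> /(@id (1 = (#|` tile n|%:R)%:E * P (aligned n 0))%E).
have /fineK <- := fin_num_measure P _ (aligned_measurable n 0).
rewrite -EFinM => -[/(congr1 ( *%R (#|` tile n|%:R^-1)))].
by rewrite mulr1 mulKf ?gt_eqF // => ->.
Qed.

(** If [u] is not inner, some [e + u] leaves the tile, so [u] is counted in the symmetric difference
    for [e], moved back by [e]. *)
Lemma boundary_cvg (E : {fset G}) :
  ((boundary E n)%:R / #|` tile n|%:R : R) @[n --> \oo] --> (0 : R).
Proof.
have sumcvg : (\sum_(e <- E) (#|` symdiff (translate e (tile n)) (tile n)|%:R /
  #|` tile n|%:R : R))
   @[n --> \oo] --> (0 : R).
  have {2}-> : 0 = \sum_(e <- E) (0 : R) by rewrite big1.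
  apply: cvg_big => [|e _]; last exact: tile_folner.2.
  by move=> y; exact: add_continuous.
apply: squeeze_cvgr sumcvg; last exact: cvg_cst.
apply: nearW => n; rewrite divr_ge0 //= -mulr_suml ler_wpM2r ?invr_ge0 //.
rewrite -natr_sum ler_nat /boundary.
rewrite -(card_fset_sep (tile n) (fun u => ~~ inner E n u)).
apply: (@leq_trans #|` fset0 `|` \bigcup_(e <- E)
   [fset (h - e)%R | h in symdiff (translate e (tile n)) (tile n)]|%fset).
  apply/fsubset_leq_card/fsubsetP => u;
    rewrite !inE => /andP[uT /fsubsetPn[_ /imfsetP[e /= eE ->] euT]].
  apply/bigfcupP; exists e; first by rewrite eE.
  apply/imfsetP; exists (e + u); last by rewrite addrAC subrr add0r.
  by rewrite /= !inE euT /=; apply/orP; left; apply/imfsetP; exists u.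
apply: leq_trans (card_bigfcup_le _ _ _) _; rewrite cardfs0 add0n.
by apply: leq_sum => e _; rewrite card_imfset //=; exact: addIr.
Qed.

(** The order of quantifiers is the point: one interval, of length tending to 0, serves all
    invariant measures. *)
Lemma visit_measure_bounds (C : set (borel X)) (E : {fset G}) n :
  (forall z z' : X, (forall g, g \in E -> val z g = val z' g) -> C z -> C z') ->
  exists a : R, forall P : probability (borel X) R, invariant_measure P ->
    (a%:E <= P C <= (a + (boundary E n)%:R / #|` tile n|%:R)%:E)%E.
Proof.
move=> EC; have [A AP] := visit_count_bounds EC n.
have mC : measurable C by apply: local_measurable; exists E.
have mV : measurable_fun (aligned n.+1 0 : set (borel X))
    (fun z => ((visit_count n.+1 C z)%:R : R)%:E).
  apply/measurable_EFinP; rewrite /visit_count.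
  rewrite (_ : (fun z => _) = (fun z : borel X =>
    \sum_(g <- tile n.+1) (\1_(act X g @^-1` C) z : R))); last first.
    by apply/funext => z; rewrite natr_sum.
  apply: measurable_sum => g; apply: measurable_indic.
  by rewrite -[_ @^-1` _]setTI; exact: act_measurable.
have mass r (P : probability (borel X) R) : invariant_measure P ->
    (\int[P]_(z in aligned n.+1 0) (cst (r%:R : R)%:E) z)%E = (r%:R / #|` tile
      n.+1|%:R)%:E.
  move=> Pinv; transitivity ((r%:R)%:E * P (aligned n.+1 0))%E.
    by apply: integral_cst; exact: aligned_measurable.
  by rewrite aligned_measure.
exists (A%:R / #|` tile n.+1|%:R) => P Pinv.
rewrite (aligned_mass n.+1 Pinv mC) -(mass A P Pinv).
have -> : A%:R / #|` tile n.+1|%:R + (boundary E n)%:R / #|` tile n|%:R =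
    (A + #|` subtiles n| * boundary E n)%:R / #|` tile n.+1|%:R :> R.
  rewrite natrD mulrDl; congr (_ + _); rewrite card_tileS !natrM.
  have S0 : #|` subtiles n|%:R != 0 :> R.
    rewrite pnatr_eq0 -lt0n cardfs_gt0; apply/fset0Pn; exists 0; exact: subtiles0.
  by field; rewrite S0 gt_eqF.
rewrite -(mass _ P Pinv); apply/andP; split; apply: ge0_le_integral.
- exact: aligned_measurable.
- by move=> z _; rewrite lee_fin.
- exact: measurable_cst.
- exact: mV.
- by move=> z /AP /andP[Az _]; rewrite lee_fin ler_nat.
- exact: aligned_measurable.
- by move=> z _; rewrite lee_fin.
- exact: mV.
- exact: measurable_cst.
- by move=> z /AP /andP[_ Az]; rewrite lee_fin ler_nat.
Qed.

Lemma array_uniquely_ergodic : uniquely_ergodic R X.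
Proof.
have cover := @tile_window G T.
have [mu muinv] := invariant_measure_exists x cover tile_folner.
exists mu; split=> // nu nuinv.
apply: (@eq_local_measure G k x tile cover R nu mu) => [|C [E EC]].
  by apply: le_lt_trans (ltry 1); rewrite -(probability_setT nu).
have mC : measurable C by apply: local_measurable; exists E.
suff : nu C = mu C by [].
have /fineK <- := fin_num_measure nu _ mC;
  have /fineK <- := fin_num_measure mu _ mC.
congr (_%:E); apply/eqP; rewrite -subr_eq0 -normr_le0;
  apply/ler_addgt0Pr => e e0; rewrite add0r.
have [n _ nP] := cvgr0_norm_lt _ (boundary_cvg E) _ e0.
have [a aP] := visit_measure_bounds n EC.
have fine_itv (b c : R) (y : \bar R) : (b%:E <= y <= c%:E)%E -> b <= fine y <= c.
  by case: y => [r| |] //=; rewrite ?lee_fin // leye_eq andbF.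
have /andP[m1 m2] := fine_itv _ _ _ (aP _ muinv).
have /andP[n1 n2] := fine_itv _ _ _ (aP _ nuinv).
have := nP n (leqnn n); rewrite ger0_norm ?divr_ge0 // => be.
by rewrite ler_norml; apply/andP; split; lra.
Qed.

End UniqueErgodicity.

(** * Choice of the blocks *)

Section Words.
Variables (T : finType) (t0 : T) (q : nat).
Local Notation letter := ('I_q.+1).
Local Notation r := #|T|.
Hypothesis qr : (q.+1 <= r)%N.

(* Each letter [v] is pinned at the place [slot v], so that every word contains
   every letter and the letter 0 is at [t0]. *)
Definition slot (v : letter) : T :=
  tperm t0 (enum_val (widen_ord qr ord0)) (enum_val (widen_ord qr v)).

Lemma slot_inj : injective slot.
Proof.
move=> u v /perm_inj /enum_val_inj /(congr1 (@nat_of_ord _)) /= uv.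
exact/ord_inj.
Qed.

Lemma slot0 : slot ord0 = t0.
Proof. by rewrite /slot tpermR. Qed.

Definition pinned : {set {ffun T -> letter}} :=
  [set w : {ffun T -> letter} | [forall v, w (slot v) == v]]%SET.

Lemma pinnedP (w : {ffun T -> letter}) : reflect (forall v,
  w (slot v) = v) (w \in pinned).
Proof. by rewrite inE; exact: 'forall_eqP. Qed.

(** A word is recovered from its pinned version and the letters that were overwritten at the
    slots. *)
Lemma card_pinned : (q.+1 ^ r <= #|pinned| * q.+1 ^ q.+1)%N.
Proof.
pose pin (w : {ffun T -> letter}) : {ffun T -> letter} :=
  [ffun t => odflt (w t) [pick v | slot v == t]].
pose f (w : {ffun T -> letter}) : {ffun T -> letter} * {ffun letter -> letter} :=
  (pin w, [ffun v => w (slot v)]).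
have pinE w v : pin w (slot v) = v.
  rewrite ffunE; case: pickP => [u /eqP /slot_inj //|/(_ v)].
  by rewrite eqxx.
have finj : injective f.
  move=> w w' [/ffunP pp /ffunP ss]; apply/ffunP => t.
  have := pp t; rewrite !ffunE; case: pickP => [v /eqP <- _|//].
  by have := ss v; rewrite !ffunE.
have := card_ffun T letter; rewrite card_ord => <-.
rewrite -[#|{ffun _}|]cardsT -(card_imset _ finj).
have -> : (q.+1 ^ q.+1 = #|[set: {ffun letter -> letter}]%SET|)%N.
  by rewrite cardsT card_ffun card_ord.
rewrite -cardsX; apply/subset_leq_card/fintype.subsetP => _ /imsetP[w _ ->].
rewrite finset.in_setX finset.in_setT andbT; apply/pinnedP; exact: pinE.
Qed.

Definition count_letter (w : {ffun T -> letter}) v := #|[set t | w t == v]%SET|.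

Definition composition (w : {ffun T -> letter}) : {ffun letter -> 'I_r.+1} :=
  [ffun v => inord (count_letter w v)].

Lemma compositionE w w' : composition w = composition w' ->
  count_letter w =1 count_letter w'.
Proof.
move=> /ffunP ww' v; have := ww' v; rewrite !ffunE => /(congr1 (@nat_of_ord _)).
by rewrite !inordK // ltnS max_card.
Qed.

Definition pinned_class c := [set w in pinned | composition w == c]%SET.

(** There are at most [r.+1 ^ q.+1] compositions; the factor [q.+1 ^ q.+1] is the price of
    pinning. *)
Lemma large_class K : (0 < K)%N -> (K * r.+1 ^ q.+1 * q.+1 ^ q.+1 <= q.+1 ^ r)%N ->
  exists c, (K <= #|pinned_class c|)%N.
Proof.
move=> K0 Kle; apply/existsP; apply: contraLR Kle;
  rewrite negb_exists => /forallP small.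
rewrite -ltnNge; apply: (leq_ltn_trans card_pinned).
rewrite ltn_pmul2r ?expn_gt0 //.
have -> : #|pinned| = (\sum_(c : {ffun letter -> 'I_r.+1}) #|pinned_class c|)%N.
  rewrite -[LHS]sum1_card (partition_big composition predT) //=.
  by apply: eq_bigr => c _; rewrite -[RHS]sum1_card; apply: eq_bigl => w;
    rewrite [RHS]inE.
apply: (@leq_ltn_trans (\sum_(c : {ffun letter -> 'I_r.+1}) K.-1)%N).
  by apply: leq_sum => c _; have := small c; rewrite -ltnNge; case: (K) K0.
rewrite sum_nat_const card_ffun !card_ord mulnC ltn_pmul2r ?expn_gt0 //.
by rewrite prednK.
Qed.

(* Exchanging two free places preserves the composition. *)
Lemma class_separation c : (1 < #|pinned_class c|)%N ->
  forall t, t != t0 -> exists2 w, w \in pinned_class c & w t != ord0.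
Proof.
move=> /card_gt1P[w [w' [wc w'c ww']]] t tt0.
have pinW u v : u \in pinned_class c -> u (slot v) = v.
  by rewrite inE => /andP[/pinnedP -> _].
(* A pinned place other than [t0] carries a nonzero letter in every word. *)
have [/codomP[v tv]|tS] := boolP (t \in codom slot).
  exists w => //; rewrite tv pinW //; apply: contraNneq tt0 => v0.
  by rewrite tv v0 slot0.
(* Two words of the class differ at some free place [t1], so one of them is nonzero there; its
   letter is then moved to [t]. *)
have /existsP[t1 wt1] : [exists t1, w t1 != w' t1].
  apply: contraNT ww'; rewrite negb_exists => /forallP ww'.
  by apply/eqP/ffunP => s; apply/eqP/negPn/ww'.
have t1S : t1 \notin codom slot.
  by apply: contraNN wt1 => /codomP[v ->]; rewrite !pinW.
have [u uc ut1] : exists2 u, u \in pinned_class c & u t1 != ord0.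
  have [w0|w0] := eqVneq (w t1) ord0; last by exists w.
  by exists w' => //; rewrite -w0 eq_sym.
exists [ffun s => u (tperm t t1 s)]; last by rewrite ffunE tpermL.
rewrite inE; apply/andP; split.
  apply/pinnedP => v; rewrite ffunE tpermD ?pinW //.
    by apply: contraNneq tS => ->; exact: codom_f.
  by apply: contraNneq t1S => ->; exact: codom_f.
move: uc; rewrite inE => /andP[_ /eqP <-]; apply/eqP/ffunP => v.
rewrite !ffunE; congr inord; rewrite /count_letter.
set u' := finfun _.
have -> : [set s | u s == v]%SET = [set tperm t t1 s | s in [set s | u' s ==
  v]%SET]%SET.
  apply/setP => s; apply/idP/imsetP => [|[s' + ->]].
    by rewrite !inE => us; exists (tperm t t1 s);
      rewrite ?tpermK // inE ffunE tpermK.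
  by rewrite !inE ffunE.
by rewrite card_imset //; exact: perm_inj.
Qed.

End Words.

Lemma subset_of_card (X : finType) (A B : {set X}) K : A \subset B ->
  (#|A| <= K)%N -> (K <= #|B|)%N ->
  exists W : {set X}, [/\ A \subset W, W \subset B & #|W| = K].
Proof.
move=> AB; elim: K => [|K IH].
  rewrite leqn0 cards_eq0 => /eqP A0 _; exists finset.set0.
  by rewrite A0 !finset.sub0set cards0.
rewrite leq_eqVlt => /orP[/eqP AK _|AK KB]; first by exists A.
have [W [AW WB WK]] := IH AK (ltnW KB).
have /fintype.subsetPn[w wB wW] : ~~ (B \subset W).
  by apply/negP => /subset_leq_card; rewrite WK leqNgt KB.
exists (w |: W)%SET; split.
- by apply: (fintype.subset_trans AW); exact: finset.subsetUr.
- by rewrite finset.subUset finset.sub1set wB.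
- by rewrite cardsU1 wW WK.
Qed.

(** Any [K] words of one large class would do, except that a separating word [wit t] must be
    included for each [t] other than [t0]; hence [#|T| <= K]. *)
Lemma words_exist (T : finType) (t0 : T) (N K : nat) :
  (1 < N <= #|T|)%N -> (1 < K)%N -> (#|T| <= K)%N ->
  (K * #|T|.+1 ^ N * N ^ N <= N ^ #|T|)%N ->
  exists w : nat -> T -> nat,
  [/\ forall j t, (j < K)%N -> (w j t < N)%N,
      forall j, w j t0 = 0%N,
      forall j v, (j < K)%N -> (v < N)%N -> exists t, w j t = v,
      forall i j v, (i < K)%N -> (j < K)%N ->
        (\sum_t (w i t == v) = \sum_t (w j t == v))%N
    & (forall t, t != t0 -> exists2 j, (j < K)%N & w j t != 0%N) /\
      forall i j, (i < K)%N -> (j < K)%N -> w i =1 w j -> i = j].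
Proof.
case: N => // q /andP[q0 qT] K1 TK Kle.
have [c cK] := large_class t0 qT (ltnW K1) Kle.
have sep := class_separation (leq_trans K1 cK).
pose wit t := odflt [ffun _ => ord0] [pick w in pinned_class t0 qT c | w t != ord0].
have witP t : t != t0 -> wit t \in pinned_class t0 qT c /\ wit t t != ord0.
  move=> /sep[w wc wt]; rewrite /wit; case: pickP => [u /andP[]//|/(_ w)].
  by rewrite /= wc wt.
have [W [AW WB WK]] : exists W : {set {ffun T -> 'I_q.+1}},
    [/\ [set wit t | t in [set~ t0]]%SET \subset W,
      W \subset pinned_class t0 qT c & #|W| = K].
  apply: subset_of_card => //.
    by apply/fintype.subsetP => _ /imsetP[t + ->]; rewrite in_setC1 => /witP[].
  apply: leq_trans TK; apply: leq_trans (leq_imset_card _ _) _; exact: max_card.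
pose w j : {ffun T -> 'I_q.+1} := nth [ffun _ => ord0] (enum W) j.
have wW j : (j < K)%N -> w j \in W.
  by move=> jK; rewrite -mem_enum mem_nth // -cardE WK.
have wpin j v : (j < K)%N -> w j (slot t0 qT v) = v.
  by move=> /wW /(fintype.subsetP WB); rewrite inE => /andP[/pinnedP -> _].
have wcnt i j : (i < K)%N -> (j < K)%N -> count_letter (w i) =1 count_letter (w j).
  move=> iK jK; apply: compositionE.
  move: (fintype.subsetP WB _ (wW _ iK)) (fintype.subsetP WB _ (wW _ jK)).
  by rewrite !inE => /andP[_ /eqP ->] /andP[_ /eqP ->].
exists (fun j t => w j t : nat); split.
- by move=> j t _; exact: ltn_ord.
(* Beyond [K] the default word is constantly 0, so the letter at [t0] is still 0. *)
- move=> j; have [jK|Kj] := ltnP j K; first by rewrite -{1}(slot0 t0 qT) wpin.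
  by rewrite /w nth_default ?ffunE // -cardE WK.
- by move=> j v jK vq; exists (slot t0 qT (Ordinal vq)); rewrite wpin.
- move=> i j v iK jK; have [vq|qv] := ltnP v q.+1; last first.
    rewrite !big1 // => t _; apply/eqP; rewrite eqb0 ltn_eqF //;
      by rewrite (leq_trans (ltn_ord _) qv).
  have cE l : (\sum_t (w l t == v :> nat) = count_letter (w l) (Ordinal vq))%N.
    rewrite /count_letter -sum1_card [RHS]big_mkcond; apply: eq_bigr => t _.
    by rewrite inE -val_eqE /=; case: eqP.
  by rewrite !cE; exact: wcnt.
split=> [t /[dup] tt0 /witP[_ wt]|i j iK jK ij].
  have : wit t \in W.
    by apply: (fintype.subsetP AW); apply/imsetP; exists t; rewrite ?inE.
  rewrite -mem_enum => /(nthP [ffun _ => ord0])[j jW jE].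
  by exists j; [rewrite -WK cardE|rewrite /w jE].
apply/eqP; rewrite -(nth_uniq [ffun _ => ord0] (s :=
  enum W)) ?enum_uniq -?cardE ?WK //.
by apply/eqP/ffunP => t; apply/ord_inj; exact: ij.
Qed.

(** * Boxes in Z^d *)

Section Boxes.
Variables (d : nat) (m : nat -> nat).
Hypothesis m_ge3 : forall n, (3 <= m n)%N.
Local Notation G := 'rV[int]_d.

Definition side n : nat := (\prod_(i < n) m i)%N.
(* The boxes are [- margin n <= g i < side n - margin n], so 0 is in the interior. *)
Definition margin n : nat := (\sum_(i < n) side i)%N.

Lemma sideS n : side n.+1 = (side n * m n)%N.
Proof. by rewrite /side big_ord_recr. Qed.

Lemma marginS n : margin n.+1 = (margin n + side n)%N.
Proof. by rewrite /margin big_ord_recr. Qed.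

Lemma side_gt0 n : (0 < side n)%N.
Proof. by apply: prodn_gt0 => i; rewrite (leq_trans _ (m_ge3 i)). Qed.

(** A factor of 3 leaves room at both ends: the slack [n] makes the boxes grow to the right, as
    [margin_ge] does to the left. *)
Lemma margin_side n : (margin n + n < side n)%N.
Proof.
elim: n => [|n IH]; first by rewrite /margin /side !big_ord0.
rewrite sideS marginS; apply: leq_trans (leq_mul (leqnn (side n)) (m_ge3 n)).
by lia.
Qed.

Lemma margin_ge n : (n <= margin n)%N.
Proof.
elim: n => [//|n IH]; rewrite marginS -addn1; apply: leq_add => //; exact: side_gt0.
Qed.

(** The base point is the multiple of [side n] lying [margin n] to the right of the left end of the
    interval, not the end itself. *)
Definition snap n (z : int) : int :=
  (side n)%:Z * ((z + (margin n)%:Z) %/ (side n)%:Z)%Z.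

Lemma side_neq0 n : (side n)%:Z != 0.
Proof. by rewrite eqz_nat -lt0n side_gt0. Qed.

Lemma snap_eq0 n z : (snap n z == 0) = (0 <= z + (margin n)%:Z < (side n)%:Z).
Proof.
have s0 : 0 < (side n)%:Z :> int by rewrite ltz_nat side_gt0.
rewrite mulf_eq0 (negbTE (side_neq0 n)) /=.
apply/eqP/andP => [q0|[z0 zs]]; last by rewrite divz_small // z0 gtz0_abs.
split.
  by rewrite {1}(divz_eq (z + (margin n)%:Z) (side n)%:Z) q0 mul0r add0r
    modz_ge0 // side_neq0.
by rewrite {1}(divz_eq (z + (margin n)%:Z) (side n)%:Z) q0 mul0r add0r ltz_pmod.
Qed.

Lemma snapD n z q : snap n (z + (side n)%:Z * q) = snap n z + (side n)%:Z * q.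
Proof.
rewrite /snap (_ : _ + _ + _ = q * (side n)%:Z + (z + (margin n)%:Z)); last by ring.
by rewrite divzMDl ?side_neq0 //; ring.
Qed.

Lemma snap0 n : snap n 0 = 0.
Proof. by apply/eqP; rewrite snap_eq0; have := margin_side n; lia. Qed.

Lemma snap_lvl0 z : snap 0 z = z.
Proof. by rewrite /snap /margin /side !big_ord0 addr0 divz1 mul1r. Qed.

(** The intervals nest because consecutive margins differ by exactly one [side n], so level-[n.+1]
    ends are level-[n] ends. *)
Lemma snap_up n z : snap n.+1 (snap n z) = snap n.+1 z.
Proof.
rewrite /snap sideS marginS !PoszM; congr (_ * _).
rewrite !divzMA_ge0 //; congr (_ %/ _)%Z.
set b := (side n)%:Z; set q := ((z + (margin n)%:Z) %/ b)%Z.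
have b0 : b != 0 by exact: side_neq0.
have ab : (Posz (margin n) %/ b)%Z = 0.
  by rewrite divz_small //; have := margin_side n; rewrite /b; lia.
rewrite !PoszD.
rewrite (_ : b * q + _ = (q + 1) * b + (margin n)%:Z); last by rewrite -/b; ring.
rewrite (_ : z + _ = 1 * b + (z + (margin n)%:Z)); last by rewrite -/b; ring.
by rewrite !divzMDl // ab -/q; ring.
Qed.

Lemma snap_down n z : snap n (snap n.+1 z) = snap n.+1 z.
Proof.
by rewrite {2 3}/snap sideS PoszM -mulrA -[X in snap n X]add0r snapD snap0 add0r.
Qed.

Definition box_corner n (g : G) : G := \row_i snap n (g 0 i).

Definition box_point n (f : {ffun 'I_d -> 'I_(side n)}) : G :=
  \row_i ((f i)%:Z - (margin n)%:Z).

Definition box n : {fset G} :=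
  [fset box_point f | f : {ffun 'I_d -> 'I_(side n)}]%fset.

Definition entry (g : G) i : int := g 0 i.

Lemma boxP n (g : G) : reflect (forall i, snap n (g 0 i) = 0) (g \in box n).
Proof.
apply: (iffP idP) => [/imfsetP[f _ ->] i|g0].
  by apply/eqP; rewrite snap_eq0 mxE subrK ltz_nat ltn_ord.
have side_cast i : (absz (entry g i + (margin n)%:Z)%R < side n)%N.
  by have /eqP := g0 i; rewrite snap_eq0 /entry; move: (g 0 i) => z; lia.
apply/imfsetP; exists [ffun i => Ordinal (side_cast i)] => //; apply/rowP => i.
rewrite mxE ffunE /=; have /eqP := g0 i; rewrite snap_eq0 /entry;
  move: (g 0 i) => z; lia.
Qed.

Fact box_corner_lvl0 (g : G) : box_corner 0 g = g.
Proof. by apply/rowP => i; rewrite mxE snap_lvl0. Qed.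

Fact box_corner0 n : box_corner n 0 = 0.
Proof. by apply/rowP => i; rewrite !mxE snap0. Qed.

Fact box_cornerD n (g h : G) : box_corner n (g + box_corner n h) = box_corner n
  g + box_corner n h.
Proof. by apply/rowP => i; rewrite !mxE -snapD. Qed.

Fact box_corner_up n (g : G) : box_corner n.+1 (box_corner n g) = box_corner n.+1 g.
Proof. by apply/rowP => i; rewrite !mxE snap_up. Qed.

Fact box_corner_down n (g : G) : box_corner n (box_corner n.+1 g) = box_corner
  n.+1 g.
Proof. by apply/rowP => i; rewrite !mxE snap_down. Qed.

Fact boxE n (g : G) : (g \in box n) = (box_corner n g == 0).
Proof.
apply/boxP/eqP => [g0|/rowP g0 i]; first by apply/rowP => i; rewrite !mxE g0.
by have := g0 i; rewrite !mxE.
Qed.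

Fact box_exhaust (g : G) : exists n, box_corner n g = 0.
Proof.
exists (\max_i absz (entry g i))%N; set n := (\max_i _)%N.
apply/eqP; rewrite -boxE; apply/boxP => i; apply/eqP; rewrite snap_eq0.
have gi : (absz (entry g i) <= n)%N by exact: (leq_bigmax (F :=
  fun i => absz (entry g i))).
by have := margin_ge n; have := margin_side n; move: gi; rewrite /entry;
  move: (g 0 i) => z; lia.
Qed.

Definition box_tiling : tiling G :=
  Tiling box_corner_lvl0 box_corner0 box_cornerD box_corner_up box_corner_down
    boxE box_exhaust.

Lemma card_box n : #|` box n| = (side n ^ d)%N.
Proof.
rewrite card_imfset /=; last first.
  move=> f f' /rowP ff'; apply/ffunP => i; apply/ord_inj.
  by have := ff' i; rewrite !mxE => /addIr [].
by rewrite -cardE card_ffun !card_ord.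
Qed.

Lemma card_subtiles n : #|` subtiles box_tiling n| = (m n ^ d)%N.
Proof.
have := card_tileS box_tiling n; rewrite /= !card_box sideS expnMn mulnC => /eqP.
by rewrite eqn_pmul2r ?expn_gt0 ?side_gt0 // => /eqP.
Qed.

Lemma latticeE n (g : G) : (g \in lattice box_tiling n) =
  [forall i, ((side n)%:Z %| entry g i)%Z].
Proof.
apply/latticeP/forallP => [gL i|gd].
  rewrite /entry -gL mxE; apply/dvdzP.
  by exists ((entry g i + (margin n)%:Z) %/ (side n)%:Z)%Z; rewrite mulrC.
apply/rowP => i; rewrite mxE -/(entry g i); have /dvdzP[q ->] := gd i.
by rewrite mulrC -[X in snap n X]add0r snapD snap0 add0r.
Qed.

Lemma card_ord_lt (b c : nat) (P : pred 'I_b) (l : nat) :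
  (forall y, P y -> (l <= y < l + c)%N) -> (#|P| <= c)%N.
Proof.
move=> Pl; rewrite cardE -(size_map val) -[X in (_ <= X)%N](size_iota l c).
apply: uniq_leq_size; first by rewrite map_inj_uniq ?enum_uniq //; exact: val_inj.
move=> _ /mapP[y + ->]; rewrite mem_enum mem_iota; exact: Pl.
Qed.

(** A point that leaves the box does so in some coordinate [i], where at most [|e i|] values
    qualify. The factor [side n] on the left avoids the exponent [d - 1]. *)
Lemma card_boundary n (e : G) :
  (#|` (box n `\` translate e (box n))%fset| * side n <=
   (\sum_i absz (entry e i)) * side n ^ d)%N.
Proof.
pose out i (y : 'I_(side n)) := ~~ (0 <= y%:Z - entry e i < (side n)%:Z).
pose F i := [set f : {ffun 'I_d -> 'I_(side n)} | out i (f i)]%SET.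
have cF i : (#|F i| * side n <= absz (entry e i) * side n ^ d)%N.
  have -> : #|F i| = #|family (fun j : 'I_d => if j == i then out i else xpredT)|.
    rewrite cardsE; apply: eq_card => f; rewrite unfold_in.
    apply/idP/forallP => [fi j|/(_ i)]; rewrite /in_mem /= ?eqxx //.
    by case: eqP => // ->.
  rewrite card_family foldrE big_map big_enum /= (bigD1 i) //= eqxx.
  rewrite (eq_bigr (fun=> side n)); last first.
    by move=> j /negbTE ->; rewrite -[RHS]card_ord; apply: eq_card.
  rewrite prod_nat_const -mulnA -expnSr (_ : (#|_|).+1 = d); last first.
    have := cardC1 i; rewrite card_ord => ->; by case: (d) i => // -[].
  rewrite leq_mul2r; apply/orP; right.
  have [e0|e0] := leP 0 (entry e i).
    apply: (@card_ord_lt _ _ _ 0) => y.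
    by rewrite /out; have := ltn_ord y;
      move: (nat_of_ord y) (entry e i) e0 => u z; lia.
  apply: (@card_ord_lt _ _ _ (side n - absz (entry e i))) => y.
  by rewrite /out; have := ltn_ord y;
    move: (nat_of_ord y) (entry e i) e0 => u z; lia.
have sub : (box n `\` translate e (box n) `<=` [fset box_point f | f in
  (\bigcup_i F i)%SET])%fset.
  apply/fsubsetP => g; rewrite inE => /andP[ge /imfsetP[f /= _ gf]].
  apply/imfsetP; exists f => //; apply/finset.bigcupP.
  have : g - e \notin box n.
    by apply: contraNN ge => ge; apply/imfsetP; exists (g - e) => //=;
      rewrite addrC subrK.
  move=> /boxP /existsNP[i /eqP]; rewrite snap_eq0 gf !mxE -/(entry e i) => ei.
  exists i => //; rewrite inE /out; move: ei; apply: contraNN.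
  by rewrite addrAC subrK.
apply: (@leq_trans (#|(\bigcup_i F i)%SET| * side n)).
  rewrite leq_mul2r; apply/orP; right; apply: leq_trans (fsubset_leq_card sub) _.
  by apply: leq_trans (leq_imfset_card _ _ _) _; rewrite -cardE.
rewrite big_distrl /=; apply: leq_trans (_ : _ <= (\sum_i #|F i|) * side n)%N _.
  by rewrite leq_mul2r card_bigcup_le orbT.
by rewrite big_distrl /=; apply: leq_sum => i _; exact: cF.
Qed.

Lemma box_folner (R : realType) : folner R (tile box_tiling).
Proof.
have box0 n : box n != fset0 by apply/fset0Pn; exists 0; rewrite boxE box_corner0.
split=> // e /=.
(* The 2 counts the halves of the symmetric difference, for [e] and [- e]; [n < side n] allows the
   comparison with [harmonic]. *)
pose c : R := (2 * \sum_i absz (entry e i))%N%:R.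
have c0 : (c * harmonic n) @[n --> \oo] --> (0 : R).
  by rewrite -[X in _ --> X](mulr0 c); apply: cvgMr; exact: cvg_harmonic.
apply: squeeze_cvgr c0; last exact: cvg_cst.
apply: nearW => n; rewrite divr_ge0 //= /harmonic.
have b0 : 0 < #|` box n|%:R :> R by rewrite ltr0n cardfs_gt0.
have s0 : 0 < (side n)%:R :> R by rewrite ltr0n side_gt0.
rewrite ler_pdivrMr // -(ler_pM2r s0).
apply: (@le_trans _ _ (c * #|` box n|%:R)); last first.
  rewrite [leRHS](_ : _ = c * #|` box n|%:R * (n.+1%:R^-1 * (side n)%:R));
    last by ring.
  rewrite ler_peMr ?mulr_ge0 ?ler0n // mulrC ler_pdivlMr ?ltr0n // mul1r ler_nat.
  by have := margin_side n; lia.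
rewrite /c -!natrM ler_nat card_box -mulnA mul2n -addnn.
rewrite /symdiff; apply: leq_trans (_ : _ <= (#|` translate e (box n) `\` box
  n|%fset + #|` box n `\` translate e (box n)|%fset) * side n)%N _.
  by rewrite leq_mul2r cardfsU leq_subr orbT.
rewrite mulnDl leq_add ?card_boundary //.
have -> : #|` translate e (box n) `\` box n|%fset = #|` box n `\` translate (-
  e) (box n)|%fset.
  have -> : (translate e (box n) `\` box n)%fset = [fset (e + h)%R | h in (box
    n `\` translate (- e) (box n))%fset]%fset.
    apply/fsetP => h; apply/idP/imfsetP => [|[u /= + ->]].
      rewrite inE => /andP[hb /imfsetP[u /= ub hu]]; exists u => //.
      rewrite inE ub andbT; apply: contraNN hb => /imfsetP[v /= vb uv].
      by rewrite hu uv addrA subrr add0r.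
    rewrite !inE => /andP[ub ubox]; apply/andP; split; last by apply/imfsetP;
      exists u.
    apply: contraNN ub => eub; apply/imfsetP; exists (e + u) => //=.
    by rewrite addrA addNr add0r.
  by rewrite card_imfset //; exact: addrI.
apply: leq_trans (card_boundary n (- e)) _.
by rewrite leq_mul2r; apply/orP; right; apply: leq_sum => i _;
  rewrite /entry mxE abszN.
Qed.

End Boxes.

(** * Finite index subgroups and universality *)

Section FiniteIndex.
Local Open Scope quotient_scope.

Lemma finite_index_multiple (G : zmodType) (H : zmodClosed G) (g : G) :
  finite_index H -> exists2 t, (0 < t)%N & g *+ t \in H.
Proof.
move=> finH.
have [t [t' [tt' E]]] : exists t t', (t < t')%N /\
    \pi_({quot H}) (g *+ t) = \pi_({quot H}) (g *+ t').
  apply: contrapT => ninj.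
  have inj : {in [set: nat] &, injective (fun t => \pi_({quot H}) (g *+ t))}.
    move=> t t' _ _ tt'; apply: contrapT => /eqP; rewrite neq_ltn => /orP[lt|lt].
      by apply: ninj; exists t, t'.
    by apply: ninj; exists t', t.
  apply: infinite_nat; apply: (@sub_finite_set _ _ ((fun t =>
    \pi_({quot H}) (g *+ t)) @^-1` setT)) => //.
  by apply: finite_preimage => //; move=> a b _ _; apply: inj; rewrite in_setT.
exists (t' - t)%N; first by rewrite subn_gt0.
by rewrite mulrnBr; [apply/pi_eqP|exact: ltnW].
Qed.

End FiniteIndex.

Section BoxUniversality.
Variables (d : nat) (m : nat -> nat).
Hypothesis m_ge3 : forall n, (3 <= m n)%N.
Hypothesis m_dvd : forall n, (n.+1 %| m n)%N.

Lemma dvdn_side t n : (0 < t)%N -> (t <= n)%N -> (t %| side m n)%N.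
Proof.
case: t => // t _ tn; rewrite /side (bigD1 (Ordinal tn)) //=.
by apply: dvdn_mulr; exact: m_dvd.
Qed.

(** [H] contains a positive multiple [t i] of each basis vector, and [side n] is divisible by every
    [t i] once [n] is at least their maximum. *)
Lemma box_cofinal (H : zmodClosed 'rV[int]_d) : finite_index H ->
  exists n, {subset lattice_scale (box_tiling d m_ge3) n <= H}.
Proof.
move=> finH.
have /choice[t tP] : forall i : 'I_d, exists t, (0 < t)%N /\
    (delta_mx 0 i : 'rV[int]_d) *+ t \in H.
  by move=> i; have [t] := finite_index_multiple (delta_mx 0 i) finH; exists t.
exists (\max_i t i)%N => g; rewrite /= latticeE => /forallP gd.
rewrite (row_sum_delta g); apply: rpred_sum => i _.
have [ti tH] := tP i.
have /dvdzP[q gq] := gd i.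
have /dvdnP[s sE] := dvdn_side ti (leq_bigmax (F := t) i).
rewrite -/(entry g i) gq sE PoszM mulrA -scalerA.
rewrite (_ : (t i)%:Z *: delta_mx 0 i = (delta_mx 0 i : 'rV[int]_d) *+ t i).
  by rewrite -[X in X *: _]intz scaler_int rpredMz.
by rewrite -[X in X *: _]intz scaler_int pmulrn.
Qed.

Lemma box_universal : universal_odometer (lattice_scale (box_tiling d m_ge3)).
Proof. by apply: universal_odometerP => H; exact: box_cofinal. Qed.

End BoxUniversality.

(** * Growth of the number of labels *)

Section Growth.
Variable R : realType.

Lemma ln_affine (e y : R) : 0 < e -> 0 < y -> ln y <= e * y - ln e.
Proof.
move=> e0 y0; have := ln_le_sub1 (mulr_gt0 e0 y0).
by rewrite lnM ?posrE //; lra.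
Qed.

Lemma ln_small (a b e : R) : 0 <= a -> 0 < e -> exists r0, forall r, (r0 <= r)%N ->
  a * ln r.+2%:R + b <= e * r%:R.
Proof.
move=> a0 e0; pose e' := e / (2 * (a + 1)).
have a1 : 0 < a + 1 by lra.
have e'0 : 0 < e' by rewrite divr_gt0 // mulr_gt0.
have ae' : a * e' <= e / 2.
  rewrite /e' invfM mulrA mulrA ler_pdivrMr //; nra.
(* [e'] spends half of [e] on the logarithm; the other half absorbs the constants once [r >= c]. The
   summand [e] is [e / 2 * 2], the cost of [r + 2] in place of [r]. *)
pose c := 2 / e * (e + b - a * ln e').
exists (Num.truncn c).+1 => r rc.
have cr : c <= r%:R.
  by apply: ltW; apply: lt_le_trans (truncnS_gt c) _; rewrite ler_nat.
have := ler_wpM2l a0 (ln_affine e'0 (ltr0Sn R r.+1)).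
have -> : r.+2%:R = r%:R + 2 :> R by rewrite -addn2 natrD.
have r0 : 0 <= r%:R :> R by [].
have H1 : a * e' * (r%:R + 2) <= e / 2 * (r%:R + 2) by rewrite ler_wpM2r //; lra.
have H2 : e + b - a * ln e' <= e / 2 * r%:R.
  move: cr; rewrite /c mulrAC ler_pdivrMr // => cr; lra.
move=> H3; apply: (@le_trans _ _ (a * (e' * (r%:R + 2) - ln e') + b));
  first by rewrite lerD2r.
rewrite mulrBr mulrA; lra.
Qed.

(* [r] extra words leave room for the separating ones. *)
Definition next_labels (y : R) (r : nat) : nat :=
  ((Num.truncn (expR (y * r%:R))).+1 + r)%N.

Lemma next_labels_gt y r : y * r%:R < ln (next_labels y r)%:R.
Proof.
rewrite -[ltLHS]expRK ltr_ln ?posrE ?expR_gt0 ?ltr0n //.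
by apply: lt_le_trans (truncnS_gt _) _; rewrite ler_nat leq_addr.
Qed.

Lemma next_labels_le y r : 0 <= y -> (next_labels y r)%:R <= expR (y * r%:R) *
  r.+2%:R.
Proof.
move=> y0; have yr : 1 <= expR (y * r%:R) by rewrite -[leLHS]expR0 ler_expR
  mulr_ge0.
have r0 : 0 <= r%:R :> R by [].
rewrite /next_labels natrD -addn1 natrD -addn2 natrD.
have := truncn_le (expR (y * r%:R)); rewrite expR_ge0 => tr.
nra.
Qed.

Lemma ln_next_labels_le y r : 0 <= y ->
  ln (next_labels y r)%:R <= y * r%:R + ln r.+2%:R.
Proof.
move=> y0; rewrite -[X in X + _]expRK -lnM ?posrE ?expR_gt0 ?ltr0n //.
rewrite ler_ln ?posrE ?mulr_gt0 ?expR_gt0 ?ltr0n //; first exact: next_labels_le.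
Qed.

(** The gain [(ln N - y) r] is linear in [r], while the logarithm of the losses is at most
    [(N + 1) ln (r + 2) + N ln N]: [N] from the compositions, 1 from [next_labels_le], the rest from
    pinning. *)
Lemma enough_words (N : nat) (y : R) : 0 <= y -> y < ln N%:R ->
  exists r0, forall r, (r0 <= r)%N -> (N <= r)%N /\
    (next_labels y r * r.+1 ^ N * N ^ N <= N ^ r)%N.
Proof.
move=> y0 yN.
have N0 : (0 < N)%N.
  by case: N yN => // ; rewrite ln0 // ltNge y0.
have N0' : 0 < N%:R :> R by rewrite ltr0n.
have dN : 0 < ln N%:R - y by lra.
have [r0 r0P] := @ln_small N.+1%:R (N%:R * ln N%:R) _ (ler0n _ _) dN.
exists (maxn N r0) => r; rewrite geq_max => /andP[Nr rr]; split=> //.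
have r20 : 0 < r.+2%:R :> R by [].
have r10 : 0 < r.+1%:R :> R by [].
rewrite -(ler_nat R) !natrM !natrX.
apply: (@le_trans _ _ (expR (y * r%:R) * r.+2%:R * r.+2%:R ^+ N * N%:R ^+ N)).
  rewrite ler_pM2r ?exprn_gt0 //; apply: ler_pM; rewrite ?exprn_ge0 //.
    exact: next_labels_le.
  by rewrite lerXn2r ?nnegrE // ler_nat.
rewrite [leLHS](_ : _ = expR (y * r%:R) * r.+2%:R ^+ N.+1 * N%:R ^+ N);
  last by rewrite exprS mulrA.
have p1 : 0 < r.+2%:R ^+ N.+1 :> R by rewrite exprn_gt0.
have p2 : 0 < N%:R ^+ N :> R by rewrite exprn_gt0.
rewrite -ler_ln ?posrE ?mulr_gt0 ?expR_gt0 ?exprn_gt0 //.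
rewrite !lnM ?posrE ?mulr_gt0 ?expR_gt0 // !lnXn // expRK.
have := r0P r rr; set lr := ln r.+2%:R; set lN := ln N%:R.
by rewrite -(mulr_natl lr) -!(mulr_natl lN) mulrBl; lra.
Qed.

End Growth.

Lemma labelling_exists (G : zmodType) (T : tiling G) (N : nat -> nat) :
  (forall n, (1 < N n)%N) ->
  (forall n, (N n <= #|` subtiles T n| <= N n.+1)%N) ->
  (forall n, (N n.+1 * #|` subtiles T n|.+1 ^ N n * N n ^ N n <=
     N n ^ #|` subtiles T n|)%N) ->
  exists L : labelling T (N 0%N), nlab L = N.
Proof.
move=> N1 Nr grow.
have /choice[w wP] : forall n, exists w : nat -> G -> nat,
  [/\ forall j s, (j < N n.+1)%N -> (w j s < N n)%N,
      forall j, w j 0 = 0%N,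
      forall j v, (j < N n.+1)%N -> (v < N n)%N ->
        exists2 s, s \in subtiles T n & w j s = v,
      forall i j v, (i < N n.+1)%N -> (j < N n.+1)%N ->
        #|` [fset s in subtiles T n | w i s == v]%fset| =
        #|` [fset s in subtiles T n | w j s == v]%fset|
    & (forall s, s \in subtiles T n -> s != 0 ->
         exists2 j, (j < N n.+1)%N & w j s != 0%N) /\
      forall i j, (i < N n.+1)%N -> (j < N n.+1)%N ->
        (forall s, s \in subtiles T n -> w i s = w j s) -> i = j].
  move=> n; have /andP[Nr1 Nr2] := Nr n.
  have [||||w [wlt w0 wonto wtype [wsep winj]]] :=
      @words_exist (subtiles T n) [` subtiles0 T n]%fset (N n) (N n.+1);
    rewrite -?cardfE ?N1 //.
  (* The value 0 outside the subtiles keeps [word_lt] true at every [s]. *)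
  pose w' j s := if insub s is Some t then w j t else 0%N.
  have w'E j (t : subtiles T n) : w' j (val t) = w j t by rewrite /w' valK.
  have w'in j s (sS : s \in subtiles T n) : w' j s = w j [` sS]%fset by rewrite
    -w'E.
  exists w'; split.
  - by move=> j s jlt; rewrite /w'; case: insub => [t|]; [exact: wlt|exact: ltnW].
  - by move=> j; rewrite (w'in _ _ (subtiles0 T n)) w0.
  - move=> j v jlt vlt; have [t tv] := wonto j v jlt vlt.
    by exists (val t); [exact: valP|rewrite w'E].
  - move=> i j v ilt jlt; rewrite !card_fset_sep !big_seq_fsetE /=.
    by under eq_bigr do rewrite w'E; under [RHS]eq_bigr do rewrite w'E;
      exact: wtype.
  split=> [s sS s0|i j ilt jlt ij].
    have [|j jlt jw] := wsep [` sS]%fset; first by rewrite -val_eqE.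
    by exists j => //; rewrite (w'in _ _ sS).
  by apply: winj => // t; rewrite -!w'E; apply: ij; exact: valP.
unshelve eexists.
  apply: (@Labelling _ T (N 0%N) N w) => // n; have [] := wP n => //.
  - by move=> *; exact: ltnW.
  - by move=> _ _ _ _ [].
  - by move=> _ _ _ _ [].
by [].
Qed.

Theorem theoremA (R : realType) (d k : nat) (hd : (1 <= d)%N) (hk : (2 <= k)%N)
    (h : R) (h_gt0 : 0 < h) (h_lt : h < ln k%:R) :
  exists x : config 'rV[int]_d k,
    [/\ toeplitz x,
        strictly_ergodic R (orbit_closure x),
        has_topological_entropy (closure (shift_orbit x)) h
      & exists s : odometer_scale 'rV[int]_d,
          universal_odometer s /\
          is_max_equicontinuous_factor (orbit_closure x) (odometer s)].
Proof.
(* A state [p] is a side with a number of labels; [rate p] is [h] times the volume of the tile. *)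
pose rate (p : nat * nat) : R := h * (p.1 ^ d)%:R.
have rate_ge0 p : 0 <= rate p by rewrite mulr_ge0 // ltW.
(* Only the last clause depends on the growth condition, so the levels can be defined by plain
   recursion and the condition proved afterwards. *)
have /choice[f fP] : forall np : nat * (nat * nat), exists m,
    [/\ (np.1.+1 %| m)%N, (3 <= m)%N & rate np.2 < ln np.2.2%:R ->
      (np.2.2 <= m ^ d)%N /\ (next_labels (rate np.2) (m ^ d) * (m ^ d).+1 ^
        np.2.2 *
         np.2.2 ^ np.2.2 <= np.2.2 ^ (m ^ d))%N].
  move=> [n p]; have [pN|pN] := boolP (rate p < ln p.2%:R); last first.
    exists (n.+1 * 3)%N; split=> [||pN'] /=; last by case/negP: pN.
      exact: dvdn_mulr.
    by rewrite leq_pmull.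
  have [r0 r0P] := enough_words (rate_ge0 p) pN.
  exists (n.+1 * (3 + r0))%N; split=> [||_] /=.
  - exact: dvdn_mulr.
  - by lia.
  apply: r0P; apply: (@leq_trans (n.+1 * (3 + r0))); first by lia.
  by rewrite -[X in (X <= _)%N]expn1 leq_pexp2l.
pose fix st n : nat * nat := if n is n'.+1 then
    ((st n').1 * f (n', st n'), next_labels (rate (st n')) (f (n', st n') ^ d))%N
  else (1, k)%N.
pose m n := f (n, st n); pose N n := (st n).2.
have m3 n : (3 <= m n)%N by have [] := fP (n, st n).
have mdvd n : (n.+1 %| m n)%N by have [] := fP (n, st n).
have sideE n : side m n = (st n).1.
  by elim: n => [|n IH]; rewrite ?sideS ?IH // /side big_ord0.
pose T := box_tiling d m3.
have tileE n : #|` tile T n|%:R = ((st n).1 ^ d)%:R :> R by rewrite card_box sideE.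
have NS n : N n.+1 = next_labels (rate (st n)) (m n ^ d) by [].
have rateS n : rate (st n.+1) = rate (st n) * (m n ^ d)%:R.
  by rewrite /rate -mulrA -natrM -expnMn.
(* The invariant of the construction. At level 0 the tile is a point and it reads [h < ln k]; its
   strictness is what [enough_words] consumes. *)
have Nrate n : rate (st n) < ln (N n)%:R.
  case: n => [|n]; last by rewrite rateS; exact: next_labels_gt.
  by rewrite /rate exp1n mulr1.
have N1 n : (1 < N n)%N.
  have := le_lt_trans (rate_ge0 _) (Nrate n).
  by case: (N n) => [|[|//]]; rewrite ?ln1 ?ln0 ?ltxx.
have subE n : #|` subtiles T n| = (m n ^ d)%N by rewrite card_subtiles.
have [n|n|L LN] := @labelling_exists _ T N N1.
- rewrite subE NS /next_labels leq_addl andbT.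
  by have [_ _ /(_ (Nrate n)) []] := fP (n, st n).
- by rewrite subE; have [_ _ /(_ (Nrate n)) []] := fP (n, st n).
have TF := @box_folner d m m3 R.
exists (array L); split.
- exact: array_toeplitz.
- by split; [exact: array_minimal|exact: array_uniquely_ergodic].
- apply: array_entropy TF (ltW h_gt0) _ _ _.
  + move=> b; exists b; rewrite card_box.
    apply: (@leq_trans (side m b)); first by have := margin_side m3 b; lia.
    by rewrite -[X in (X <= _)%N]expn1 leq_pexp2l // side_gt0.
  + by move=> n; rewrite LN tileE; exact/ltW/Nrate.
  (* As [r0.+1] divides [m r0], the multiplier is large enough for the excess [ln (m ^ d + 2)] to be
     at most [e] times the volume at level [r0.+1]. *)
  move=> e e0; have [r0 r0P] := @ln_small R 1 0 e ler01 e0.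
  exists r0.+1; rewrite LN NS tileE mulrDl -/(rate (st r0.+1)) rateS.
  apply: le_trans (ln_next_labels_le _ (rate_ge0 _)) _; rewrite lerD2l.
  have mr : (r0 <= m r0 ^ d)%N.
    apply: (@leq_trans (m r0)).
      by apply: ltnW; apply: dvdn_leq (mdvd r0); have := m3 r0; lia.
    by rewrite -[X in (X <= _)%N]expn1 leq_pexp2l //; have := m3 r0; lia.
  have := r0P _ mr; rewrite mul1r addr0 => /le_trans; apply.
  rewrite (ler_wpM2l (ltW e0)) // ler_nat /= expnMn leq_pmull // expn_gt0.
  by rewrite -sideE side_gt0.
exists (lattice_scale T); split; first exact: box_universal.
exact: array_max_equicontinuous_factor.
Qed.
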